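(* Let $(\mathcal{M},\theta)$ be a compact metric space with a Borel probability measure $\mu$, and suppose that $(\mathcal{M},\theta,\mu)$ is $d$-rectifiable, with associated map $f:\mathcal{O}\to\mathcal{M}$ having Lipschitz constant $\mathrm{Lip}(f)$. Then the following hold. (i) If a metric $\rho$ on $\mathcal{M}$ satisfies $\rho(x_1,x_2)\le c_0\,\theta(x_1,x_2)$ for all $x_1,x_2\in\mathcal{M}$, with a constant $c_0>0$, then for each integer $N\ge 1$, $$\rho_N\ \ge\ \langle\rho\rangle N^2-d\,2^{d-1}\,\mathrm{Lip}(f)\,c_0\,N^{1-1/d}.$$ (ii) If a non-negative Borel measure $\xi$ on the set of radii $T$ satisfies $\xi([a,b))\le c_0(\xi)\,|a-b|$ for all $a,b\in T$ with $a\le b$, with a constant $c_0(\xi)>0$ (here $[a,b)$ means $[a,b)\cap T$), then for each integer $N\ge1$, $$\lambda_N(\xi)\ \le\ d\,2^{d-3}\,\mathrm{Lip}(f)\,c_0(\xi)\,N^{1-1/d}.$$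
   Context: $d$-rectifiable: a compact metric space $(\mathcal{M},\theta)$ with Borel probability measure $\mu$ is $d$-rectifiable if there exist a finite non-negative measure $\nu$ on the unit cube $I^d=[0,1]^d$, absolutely continuous with respect to $d$-dimensional Lebesgue measure, a measurable subset $\mathcal{O}\subset I^d$, and an injective Lipschitz map $f:\mathcal{O}\to\mathcal{M}$ (with respect to the Euclidean metric $\|\cdot\|$ on $\mathcal{O}$ and $\theta$ on $\mathcal{M}$) such that $\mu(\mathcal{M}\setminus f(\mathcal{O}))=0$ and $\mu(\mathcal{E})=\nu(f^{-1}(\mathcal{E}\cap f(\mathcal{O})))$ for every $\mu$-measurable $\mathcal{E}\subset\mathcal{M}$. $\mathrm{Lip}(f)$ is the smallest $c$ with $\theta(f(Z_1),f(Z_2))\le c\|Z_1-Z_2\|$ for all $Z_1,Z_2\in\mathcal{O}$. For a metric $\rho$ on $\mathcal{M}$: $\rho[\mathcal{D}_N]=\sum_{x_1,x_2\in\mathcal{D}_N}\rho(x_1,x_2)$ for an $N$-point subset $\mathcal{D}_N\subset\mathcal{M}$; $\rho_N=\sup_{\mathcal{D}_N}\rho[\mathcal{D}_N]$ over all $N$-point subsets; $\langle\rho\rangle=\iint_{\mathcal{M}\times\mathcal{M}}\rho(y_1,y_2)\,d\mu(y_1)\,d\mu(y_2)$. Set of radii: $T=\{\theta(y_1,y_2):y_1,y_2\in\mathcal{M}\}$. Balls: $B_r(y)=\{x\in\mathcal{M}:\theta(x,y)\le r\}$, $r\in T$, $y\in\mathcal{M}$. Discrepancies: $\Lambda[B_r(y),\mathcal{D}_N]=\#(B_r(y)\cap\mathcal{D}_N)-N\mu(B_r(y))$,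 $\lambda_r[\mathcal{D}_N]=\int_{\mathcal{M}}\Lambda[B_r(y),\mathcal{D}_N]^2\,d\mu(y)$, $\lambda[\xi,\mathcal{D}_N]=\int_T\lambda_r[\mathcal{D}_N]\,d\xi(r)$, and $\lambda_N(\xi)=\inf_{\mathcal{D}_N}\lambda[\xi,\mathcal{D}_N]$ over all $N$-point subsets $\mathcal{D}_N\subset\mathcal{M}$. *)

(* Defs.v *)
From HB Require Import structures.
From mathcomp Require Import all_boot all_order all_algebra finmap.
From mathcomp Require Import all_classical all_reals all_analysis.

Set Implicit Arguments.
Unset Strict Implicit.
Unset Printing Implicit Defensive.
Import Order.TTheory GRing.Theory Num.Theory.
Import numFieldNormedType.Exports.
Local Open Scope classical_set_scope.
Local Open Scope ring_scope.

(* Generated sigma-algebras need a pointed carrier; a space that carries a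
   probability measure is inhabited, so this is no restriction. *)
#[short(type="pmetricType")]
HB.structure Definition PointedMetric (K : numDomainType) :=
  { M of Pointed M & Metric K M }.

Notation borel M := (g_sigma_algebraType (@open M)).

Section LebesgueTuple.
Context {R : realType}.

Definition tuple_cons n (p : R * n.-tuple R) : n.+1.-tuple R :=
  [tuple of p.1 :: p.2].

Lemma measurable_tuple_cons n :
  measurable_fun [set: R * n.-tuple R] (@tuple_cons n).
Proof. exact: (measurable_cons (f := fst) (g := snd)). Qed.

Definition lebesgue_cons n (m : {measure set (n.-tuple R) -> \bar R}) :=
  pushforward (@lebesgue_measure R \x^ m)%E (@tuple_cons n).

Section LebesgueCons.
Context n (m : {measure set (n.-tuple R) -> \bar R}).

Let lebesgue_cons0 : lebesgue_cons m set0 = 0%E.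
Proof. by rewrite /lebesgue_cons /pushforward preimage_set0 measure0. Qed.

Let lebesgue_cons_ge0 A : (0 <= lebesgue_cons m A)%E.
Proof. by rewrite /lebesgue_cons /pushforward measure_ge0. Qed.

Let lebesgue_cons_sigma_additive : semi_sigma_additive (lebesgue_cons m).
Proof.
apply: (@measure_semi_sigma_additive _ _ _
  (pushforward (@lebesgue_measure R \x^ m)%E (@tuple_cons n))).
exact: measurable_tuple_cons.
Qed.

HB.instance Definition _ := isMeasure.Build _ _ _ (lebesgue_cons m)
  lebesgue_cons0 lebesgue_cons_ge0 lebesgue_cons_sigma_additive.
End LebesgueCons.

(* n-dimensional Lebesgue measure, as an iterated product measure. *)
Fixpoint lebesgue_tuple n : {measure set (n.-tuple R) -> \bar R} :=
  if n is n'.+1 then lebesgue_cons (lebesgue_tuple n') else \d_[tuple].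

Definition unit_cube n : set (n.-tuple R) :=
  [set z | forall i, 0 <= tnth z i <= 1].

Definition eucl_dist n (z1 z2 : n.-tuple R) : R :=
  Num.sqrt (\sum_(i < n) (tnth z1 i - tnth z2 i) ^+ 2).
End LebesgueTuple.

Section Rectifiable.
Context {R : realType} {M : pmetricType R} {d : nat}.
Implicit Types (O : set (d.-tuple R)) (f : d.-tuple R -> M).

Definition lipschitz_bounds O f : set R :=
  [set c | forall z1 z2, O z1 -> O z2 ->
     mdist (f z1) (f z2) <= c * eucl_dist z1 z2].

Definition Lip O f : R := inf (lipschitz_bounds O f).

(* [mu^*] and [nu^*] are the outer measures of [mu] and [nu]; they extend them
   to the completed sigma-algebras, i.e. to the Caratheodory-measurable sets.
   The map [f] is total but only its restriction to [O] matters.  The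
   preimage in the last clause is always [nu^*]-measurable: [f] is continuous
   on the Lebesgue measurable set [O], and the clause itself makes preimages of
   [mu]-negligible sets [nu]-negligible. *)
Definition rectification (mu : probability (borel M) R)
    (nu : {finite_measure set (d.-tuple R) -> \bar R}) O f : Prop :=
  [/\ nu (~` @unit_cube R d) = 0%E /\ nu `<< @lebesgue_tuple R d,
      O `<=` @unit_cube R d /\ ((@lebesgue_tuple R d)^*)%mu.-cara.-measurable O,
      {in O &, injective f} /\ lipschitz_bounds O f !=set0,
      mu.-negligible (~` (f @` O)) &
      forall E : set M, (mu^*)%mu.-cara.-measurable E ->
        (mu^*)%mu E = (nu^*)%mu (O `&` f @^-1` (E `&` f @` O))].
End Rectifiable.

Definition is_metric (R : realType) (M : Type) (rho : M -> M -> R) : Prop :=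
  [/\ forall x y, 0 <= rho x y,
      forall x y, rho x y = 0 <-> x = y,
      forall x y, rho x y = rho y x &
      forall x y z, rho x z <= rho x y + rho y z].

Definition npoint_subsets (M : choiceType) (N : nat) : set {fset M} :=
  [set D | #|` D| = N].

Section Energy.
Context {R : realType} {M : pmetricType R}.
Implicit Types (mu : probability (borel M) R) (rho : M -> M -> R).

Definition metric_sum rho (D : {fset M}) : R :=
  \sum_(x1 <- D) \sum_(x2 <- D) rho x1 x2.

Definition max_metric_sum rho (N : nat) : \bar R :=
  ereal_sup [set (metric_sum rho D)%:E | D in @npoint_subsets M N].

Definition mean_metric mu rho : \bar R :=
  (\int[mu]_y1 \int[mu]_y2 (rho y1 y2)%:E)%E.
End Energy.

Section Discrepancy.
Context {R : realType} {M : pmetricType R}.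
Implicit Types (mu : probability (borel M) R) (r : R) (y : M) (D : {fset M}).

Definition radii : set R := [set r | exists y1 y2 : M, r = mdist y1 y2].

Definition cball r y : set M := [set x | mdist x y <= r].

Definition local_discrepancy mu r y D : R :=
  (#|` [fset x in D | x \in cball r y]%fset|)%:R
    - (#|` D|)%:R * fine (mu (cball r y)).

Definition discrepancy_at mu r D : \bar R :=
  (\int[mu]_y ((local_discrepancy mu r y D) ^+ 2)%:E)%E.

(* A measure on [radii] is represented by a measure on the line, of which only
   the restriction to [radii] (a closed set when [M] is compact) is used. *)
Definition discrepancy mu (xi : {measure set R -> \bar R}) D : \bar R :=
  (\int[xi]_(r in radii) discrepancy_at mu r D)%E.

Definition min_discrepancy mu (xi : {measure set R -> \bar R}) (N : nat) :
    \bar R :=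
  ereal_inf [set discrepancy mu xi D | D in @npoint_subsets M N].
End Discrepancy.
Arguments radii {R} M.

(* Main.v *)
(* The cube is cut by axis-parallel hyperplanes, direction by direction, into N
   pieces of equal nu-measure whose diameters add up to at most
   d 2^(d-1) N^(1-1/d); the map f carries them to a partition of M, up to a null
   set, into pieces V_1, ..., V_N of measure 1/N. Put one random point in each
   V_i, independently and distributed according to N mu.

   (i) The expected sum of distances is N^2 <rho> minus the contributions of the
   pairs inside one V_i, each of which is at most c0 diam V_i.

   (ii) With p_i = N mu(B_r(y) inter V_i) the expectation of Lambda^2 is the sum of
   the variances p_i (1 - p_i). These are at most 1/4 and vanish unless r lies in
   an interval of length at most diam V_i, whence the constant 1/8 = 1/2 * 1/4.

   In both cases the points are selected one at a time, which needs only Fubini on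
   products of two spaces. *)
Require Import Defs.
From HB Require Import structures.
From mathcomp Require Import all_boot all_order all_algebra finmap.
From mathcomp Require Import all_classical all_reals all_analysis.
From mathcomp Require Import measurable_realfun ring lra zify.
Import Order.TTheory GRing.Theory Num.Theory.
Import numFieldNormedType.Exports.
Local Open Scope classical_set_scope.
Local Open Scope ring_scope.

Set Implicit Arguments.
Unset Strict Implicit.
Unset Printing Implicit Defensive.

(** * Bounded measurable functions *)

(** Exact cuts exist because [nu] is absolutely continuous and hyperplanes are Lebesgue-null. The
    difficulty is that N need not be a d-th power, so the numbers of pieces per slab and of slabs
    are rounded up. Each level of slabs costs a factor of at most 2, except the last one, which
    splits off single pieces and needs no rounding; this leaves 2^(d-1). Each averaging step must
    produce a point of the piece itself, not merely a typical point: the N images are known to be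
    distinct only for points taken from disjoint pieces, and a repeated point would spoil the
    N-point set. *)

Section BoundedMeasurable.
Context d (T : measurableType d) (R : realType).
Implicit Types (f g : T -> R) (m : {finite_measure set T -> \bar R}).

(** For finite measures these functions are integrable, and the class is closed under the algebraic
    operations and under partial integration, so linearity and Fubini come without separate
    integrability conditions. *)
Definition bmeasurable f : Prop :=
  measurable_fun [set: T] f /\ exists C, forall x, `|f x| <= C.

Lemma bmeasurable_cst c : bmeasurable (fun=> c).
Proof. by split; [exact: measurable_cst|exists `|c|]. Qed.

Lemma bmeasurableD f g :
  bmeasurable f -> bmeasurable g -> bmeasurable (fun x => f x + g x).
Proof.
move=> [mf [C fC]] [mg [C' gC]]; split; first exact: measurable_funD.
by exists (C + C') => x; rewrite (le_trans (ler_normD _ _))// lerD.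
Qed.

Lemma bmeasurableM f g :
  bmeasurable f -> bmeasurable g -> bmeasurable (fun x => f x * g x).
Proof.
move=> [mf [C fC]] [mg [C' gC]]; split; first exact: measurable_funM.
by exists (C * C') => x; rewrite normrM ler_pM.
Qed.

Lemma bmeasurableZ c f : bmeasurable f -> bmeasurable (fun x => c * f x).
Proof. by move=> bf; apply: bmeasurableM => //; exact: bmeasurable_cst. Qed.

Lemma bmeasurableB f g :
  bmeasurable f -> bmeasurable g -> bmeasurable (fun x => f x - g x).
Proof.
move=> bf bg; under eq_fun do rewrite -mulN1r.
by apply: bmeasurableD => //; exact: bmeasurableZ.
Qed.

Lemma bmeasurable_sum I (s : seq I) (f : I -> T -> R) :
  (forall i, bmeasurable (f i)) -> bmeasurable (fun x => \sum_(i <- s) f i x).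
Proof.
move=> bf; elim: s => [|i s IH].
  by under eq_fun do rewrite big_nil; exact: bmeasurable_cst.
by under eq_fun do rewrite big_cons; exact: bmeasurableD.
Qed.

Lemma bmeasurable_integrable m f :
  bmeasurable f -> m.-integrable [set: T] (EFin \o f).
Proof.
move=> [mf [C fC]]; apply: measurable_bounded_integrable => //.
  exact/fin_num_fun_lty/fin_num_measure.
exists C; split; first exact: num_real.
by move=> M CM x _ /=; rewrite (le_trans (fC x))// ltW.
Qed.

Lemma EFin_Rintegral m f : bmeasurable f ->
  (\int[m]_x f x)%:E = (\int[m]_x (f x)%:E)%E.
Proof.
by move=> bf; rewrite fineK//; exact/integrable_fin_num/bmeasurable_integrable.
Qed.

Lemma bRintegralD m f g : bmeasurable f -> bmeasurable g ->
  \int[m]_x (f x + g x) = \int[m]_x f x + \int[m]_x g x.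
Proof. by move=> ? ?; apply: RintegralD => //; exact: bmeasurable_integrable. Qed.

Lemma bRintegralB m f g : bmeasurable f -> bmeasurable g ->
  \int[m]_x (f x - g x) = \int[m]_x f x - \int[m]_x g x.
Proof. by move=> ? ?; apply: RintegralB => //; exact: bmeasurable_integrable. Qed.

Lemma bRintegralZ m c f : bmeasurable f ->
  \int[m]_x (c * f x) = c * \int[m]_x f x.
Proof. by move=> ?; apply: RintegralZl => //; exact: bmeasurable_integrable. Qed.

Lemma bRintegral_sum m I (s : seq I) (f : I -> T -> R) :
  (forall i, bmeasurable (f i)) ->
  \int[m]_x (\sum_(i <- s) f i x) = \sum_(i <- s) \int[m]_x f i x.
Proof.
move=> bf; elim: s => [|i s IH].
  rewrite big_nil; under eq_Rintegral do rewrite big_nil.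
  by rewrite Rintegral_cst// mul0r.
rewrite big_cons -IH -bRintegralD//; last exact: bmeasurable_sum.
by apply: eq_Rintegral => x _; rewrite big_cons.
Qed.

Lemma le_bRintegral m f g : bmeasurable f -> bmeasurable g ->
  (forall x, f x <= g x) -> \int[m]_x f x <= \int[m]_x g x.
Proof. by move=> ? ? ?; apply: le_Rintegral => //; exact: bmeasurable_integrable. Qed.

(** If [f] stayed below its mean [c] on [W], then [c - f] would be positive on [W] with integral
    zero, so [W], which carries all the mass, would be null. *)
Lemma bRintegral_exists m (W : set T) f : measurable W -> m (~` W) = 0%E ->
  (0 < m [set: T])%E -> bmeasurable f ->
  exists2 z, W z & \int[m]_x f x <= f z * fine (m [set: T]).
Proof.
move=> mW mW0 m0 bf; apply: contrapT => /forall2NP H.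
have mT : m [set: T] \is a fin_num by exact: fin_num_measure.
have mT0 : 0 < fine (m [set: T]).
  by rewrite fine_gt0// m0 ltey_eq mT.
pose c := (\int[m]_x f x) / fine (m [set: T]).
have fc z : W z -> f z < c.
  by move=> Wz; have [//|/negP] := H z; rewrite -ltNge /c ltr_pdivlMr.
have bh : bmeasurable (fun x => c - f x).
  by apply: bmeasurableB => //; exact: bmeasurable_cst.
have h0 : (\int[m]_x (c - f x)%:E = 0)%E.
  rewrite -EFin_Rintegral// bRintegralB//; last exact: bmeasurable_cst.
  by rewrite Rintegral_cst// /c divfK ?gt_eqF// subrr.
have hW : (\int[m]_(x in W) `|(c - f x)%:E| = 0)%E.
  rewrite -h0 [RHS](negligible_integral (N := ~` W))//; last 2 first.
    exact: measurableC.
    exact: bmeasurable_integrable.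
  rewrite setTD setCK; apply: eq_integral => x; rewrite inE => Wx.
  by rewrite gee0_abs// lee_fin subr_ge0 ltW// fc.
pose g : T -> \bar R := fun x => (c - f x)%:E.
have mh : measurable_fun W g.
  by apply/measurable_EFinP/measurable_funTS; case: bh.
have /(ae_eq_integral_abs m mW mh) [N [mN N0 WN]] := hW.
have WsubN : W `<=` N.
  move=> x Wx; apply: WN => /= /(_ Wx) /eqP.
  by rewrite eqe subr_eq0 gt_eqF// fc.

have : (m [set: T] <= 0)%E.
  have -> : m [set: T] = (m W + m (~` W))%E.
    by rewrite -measureU// ?setUv ?setICr//; exact: measurableC.
  by rewrite mW0 adde0 -N0 le_measure// inE.
by rewrite leNgt m0.
Qed.

Lemma bRintegral_le_cst m (W : set T) f c : measurable W -> m (~` W) = 0%E ->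
  (0 < m [set: T])%E -> bmeasurable f -> (forall z, W z -> f z <= c) ->
  \int[m]_x f x <= c * fine (m [set: T]).
Proof.
move=> mW mW0 m0 bf fc; have [z Wz] := bRintegral_exists mW mW0 m0 bf.
by move/le_trans; apply; rewrite ler_wpM2r ?fine_ge0// fc.
Qed.

Lemma bRintegral_measure_sum m (m_ : nat -> {finite_measure set T -> \bar R}) N f :
  (forall A, measurable A -> m A = (\sum_(i < N) m_ i A)%E) -> bmeasurable f ->
  \int[m]_x f x = \sum_(i < N) \int[m_ i]_x f x.
Proof.
move=> mE bf.
have pos g : bmeasurable g -> (forall x, 0 <= g x) ->
    \int[m]_x g x = \sum_(i < N) \int[m_ i]_x g x.
  move=> bg g0; apply: EFin_inj; rewrite -sumEFin EFin_Rintegral//.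
  rewrite (eq_measure_integral (msum m_ N)); last by move=> A mA _; exact: mE.
  rewrite ge0_integral_measure_sum//.
  - by apply: eq_bigr => i _; rewrite -EFin_Rintegral.
  - by move=> x _; rewrite lee_fin.
  - by apply/measurable_EFinP; case: bg.
(* Adding the bound [C] makes [f] nonnegative, and the integral of [C] cancels from both sides. The
   bound at [point] gives [0 <= C]. *)
have [_ [C fC]] := bf.
have bC := @bmeasurable_cst C.
have Cf0 x : 0 <= C + f x.
  by rewrite -lerBlDl sub0r; have := fC x; rewrite ler_norml => /andP[].
have := pos _ (bmeasurableD bC bf) Cf0.
rewrite bRintegralD// pos//; last by move=> x; exact: le_trans (fC point).
under [RHS]eq_bigr do rewrite bRintegralD//.
by rewrite big_split/= => /addrI.
Qed.

End BoundedMeasurable.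

Lemma bmeasurable_comp d1 d2 (T1 : measurableType d1) (T2 : measurableType d2)
    (R : realType) (phi : T1 -> T2) (f : T2 -> R) :
  measurable_fun [set: T1] phi -> bmeasurable f -> bmeasurable (f \o phi).
Proof.
move=> mphi [mf [C fC]]; split; first exact: measurableT_comp.
by exists C => x; exact: fC.
Qed.

Section BoundedFubini.
Context d1 d2 (T1 : measurableType d1) (T2 : measurableType d2) (R : realType).
Variables (m1 : {finite_measure set T1 -> \bar R})
  (m2 : {finite_measure set T2 -> \bar R}).
Implicit Type F : T1 * T2 -> R.

Lemma bmeasurable_pair2 F x : bmeasurable F -> bmeasurable (fun y => F (x, y)).
Proof.
by apply: (@bmeasurable_comp _ _ _ _ _ (fun y => (x, y))); exact: pair1_measurable.
Qed.

Lemma bmeasurable_pair1 F y : bmeasurable F -> bmeasurable (fun x => F (x, y)).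
Proof.
by apply: (@bmeasurable_comp _ _ _ _ _ (fun x => (x, y))); exact: pair2_measurable.
Qed.

(** Named separately so that the product can carry the structure of a finite measure; it later
    becomes the joint measure on radii and centres of balls. *)
Definition finite_product : set (T1 * T2)%type -> \bar R := (m1 \x m2)%E.

HB.instance Definition _ := Measure.on finite_product.

Let finite_product_fin_num : fin_num_fun finite_product.
Proof.
apply: lty_fin_num_fun; rewrite -setXTT.
rewrite [ltLHS](product_measure1E m1 m2 measurableT measurableT).
by rewrite lte_mul_pinfty// ?fin_num_measure//; exact/fin_num_fun_lty/fin_num_measure.
Qed.

HB.instance Definition _ := Measure_isFinite.Build _ _ _ finite_product finite_product_fin_num.

Lemma bmeasurable_Rintegral F : bmeasurable F ->
  bmeasurable (fun x => \int[m2]_y F (x, y)).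
Proof.
move=> bF; split.
  apply: (measurableT_comp (f := fine)) => //.
  have := @measurable_fubini_F _ _ _ _ _ m1 m2 (EFin \o F) _; apply.
  exact: (@bmeasurable_integrable _ _ _ finite_product).
have [_ [C FC]] := bF.
exists (C * fine (m2 [set: T2])) => x.
have bFx := bmeasurable_pair2 x bF.
rewrite -Rintegral_cst// (le_trans (le_normr_Rintegral _ _))//.
  exact: bmeasurable_integrable.
apply: le_bRintegral => //; last exact: bmeasurable_cst.
by split; [apply: measurableT_comp => //; case: bFx|exists C => y; rewrite normr_id].
Qed.

Lemma Rintegral_prod F : bmeasurable F ->
  \int[finite_product]_z F z = \int[m1]_x \int[m2]_y F (x, y).
Proof.
move=> bF; rewrite /Rintegral.
rewrite -(integral12_prod_meas1 (f := EFin \o F)); last first.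
  exact: (@bmeasurable_integrable _ _ _ finite_product).
congr fine; apply: eq_integral => x _.
by rewrite [RHS]EFin_Rintegral//; exact: bmeasurable_pair2.
Qed.

Lemma bRintegral_swap F : bmeasurable F ->
  \int[m1]_x \int[m2]_y F (x, y) = \int[m2]_y \int[m1]_x F (x, y).
Proof.
move=> bF; rewrite -Rintegral_prod// /Rintegral.
rewrite -(integral21_prod_meas1 (f := EFin \o F)); last first.
  exact: (@bmeasurable_integrable _ _ _ finite_product).
congr fine; apply: eq_integral => x _.
by rewrite [RHS]EFin_Rintegral//; exact: bmeasurable_pair1.
Qed.

End BoundedFubini.

(** * Selection of points *)

Section Selection.
Context d (T : measurableType d) (R : realType).
Variables (m : nat -> {finite_measure set T -> \bar R}) (W : nat -> set T).
Variables (n : R) (N : nat).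
Hypothesis n_gt0 : 0 < n.

Definition concentrated i : Prop :=
  [/\ measurable (W i), m i (~` W i) = 0%E & m i [set: T] = n^-1%:E].

Lemma concentrated_exists i f : concentrated i -> bmeasurable f ->
  exists2 z, W i z & n * \int[m i]_x f x <= f z.
Proof.
move=> [mW mW0 mT] bf.
have m0 : (0 < m i [set: T])%E by rewrite mT lte_fin invr_gt0.
have [z Wz H] := bRintegral_exists mW mW0 m0 bf; exists z => //.
by rewrite -ler_pdivlMl// mulrC (le_trans H)// mT.
Qed.

(* The last point is chosen first; its interaction with the others is then
   absorbed into [g], so no symmetry of [K] is needed. *)
Lemma select_kernel (K : T * T -> R) (g : nat -> T -> R) :
  (forall i, (i < N)%N -> concentrated i) ->
  bmeasurable K -> (forall i, bmeasurable (g i)) ->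
  exists2 z : nat -> T, (forall i, (i < N)%N -> W i (z i)) &
    \sum_(i < N) (\sum_(j < i) n ^+ 2 * \int[m i]_x \int[m j]_y K (x, y)
                  + n * \int[m i]_x g i x)
    <= \sum_(i < N) (\sum_(j < i) K (z i, z j) + g i (z i)).
Proof.
elim: N g => [|k IH] g cW bK bg.
  by exists (fun=> point) => //; rewrite !big_ord0.
pose h x := \sum_(j < k) n * \int[m j]_y K (x, y) + g k x.
have bKj (j : 'I_k) : bmeasurable (fun x => \int[m j]_y K (x, y)).
  exact: (bmeasurable_Rintegral (m 0%N)).
have bs : bmeasurable (fun x => \sum_(j < k) n * \int[m j]_y K (x, y)).
  by apply: bmeasurable_sum => j; exact: bmeasurableZ.
have bh : bmeasurable h by exact: bmeasurableD.
have [x Wx hx] := concentrated_exists (cW k (ltnSn k)) bh.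
have bKx : bmeasurable (fun y => K (x, y)) by exact: bmeasurable_pair2.
have [||z Wz IHz] := IH (fun i y => g i y + K (x, y)) _ bK.
- by move=> i ik; apply: cW; exact: ltnW.
- by move=> i; exact: bmeasurableD.
exists (fun i => if i == k then x else z i).
  move=> i; rewrite ltnS leq_eqVlt; case: eqP => [->//|_ /= ik]; exact: Wz.
rewrite !big_ord_recr/= eqxx.
have -> : \sum_(j < k) n ^+ 2 * \int[m k]_x0 \int[m j]_y K (x0, y)
    + n * \int[m k]_x0 g k x0 = n * \int[m k]_x0 h x0.
  rewrite /h bRintegralD// mulrDr; congr (_ + _).
  rewrite bRintegral_sum; last by move=> j; exact: bmeasurableZ.
  rewrite mulr_sumr; apply: eq_bigr => j _.
  by rewrite bRintegralZ// expr2 mulrA.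
have zi (i : 'I_k) : (if i == k :> nat then x else z i) = z i.
  by rewrite ltn_eqF.
have -> : \sum_(i < k) (\sum_(j < i) K (if i == k :> nat then x else z i,
      if j == k :> nat then x else z j) + g i (if i == k :> nat then x else z i))
    + (\sum_(j < k) K (x, if j == k :> nat then x else z j) + g k x) =
    \sum_(i < k) (\sum_(j < i) K (z i, z j) + (g i (z i) + K (x, z i))) + g k x.
  rewrite addrA; congr (_ + _); rewrite -big_split/=; apply: eq_bigr => i _.
  rewrite !zi addrA; congr (_ + _ + _); apply: eq_bigr => j _.
  by rewrite ltn_eqF// (ltn_trans (ltn_ord j)).
apply: le_trans (lerD IHz (lexx (g k x))).
apply: le_trans (lerD (lexx _) hx) _.
rewrite /h addrA lerD2r -big_split/= ler_sum// => i _.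
by rewrite bRintegralD// mulrDr addrA.
Qed.

(* [p i u] is the mean of [chi (u, _)] over the [i]-th piece. The points are
   chosen one after the other: averaging over the new point kills the cross term
   of the square and leaves the Bernoulli variance [p * (1 - p)]. *)
Lemma select_variance d' (U : measurableType d')
    (pi : {finite_measure set U -> \bar R}) (chi : U * T -> R) :
  (forall i, (i < N)%N -> concentrated i) ->
  bmeasurable chi -> (forall w, chi w ^+ 2 = chi w) ->
  let p i u := n * \int[m i]_z chi (u, z) in
  exists2 z : nat -> T, (forall i, (i < N)%N -> W i (z i)) &
    \int[pi]_u ((\sum_(i < N) (chi (u, z i) - p i u)) ^+ 2)
    <= \sum_(i < N) \int[pi]_u (p i u * (1 - p i u)).
Proof.
move=> + bchi chi2 p; elim: N => [|k IH] cW.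
  exists (fun=> point) => //; rewrite big_ord0.
  under eq_Rintegral do rewrite big_ord0 expr0n.
  by rewrite Rintegral_cst// mul0r.
have [i ik|z Wz IHz] := IH; first by apply: cW; exact: ltnW.
have bchiz x : bmeasurable (fun u => chi (u, x)) by exact: bmeasurable_pair1.
have bchiu u : bmeasurable (fun x => chi (u, x)) by exact: bmeasurable_pair2.
have bp i : bmeasurable (p i).
  by apply: bmeasurableZ; exact: (bmeasurable_Rintegral pi).
pose S u := \sum_(i < k) (chi (u, z i) - p i u).
have bS : bmeasurable S by apply: bmeasurable_sum => i; exact: bmeasurableB.
pose F w := (S w.1 + (chi w - p k w.1)) ^+ 2.
have bF : bmeasurable F.
  rewrite /F; under eq_fun do rewrite expr2.
  have b1 f : bmeasurable f -> bmeasurable (fun w : U * T => f w.1).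
    by apply: (@bmeasurable_comp _ _ _ _ _ fst); exact: measurable_fst.
  have bSF : bmeasurable (fun w => S w.1 + (chi w - p k w.1)).
    by apply: bmeasurableD; [exact: b1|apply: bmeasurableB => //; exact: b1].
  exact: bmeasurableM.
(* The sign turns the lower bound of [concentrated_exists] into an upper bound for the integral of
   the square. *)
pose h x := - \int[pi]_u F (u, x).
have bFs : bmeasurable (fun w : T * U => F (w.2, w.1)).
  apply: (@bmeasurable_comp _ _ _ _ _ (fun w : T * U => (w.2, w.1))) => //.
  exact: measurable_swap.
have bFx : bmeasurable (fun x => \int[pi]_u F (u, x)).
  exact: (bmeasurable_Rintegral (m 0%N) pi bFs).
have bh : bmeasurable h.
  by rewrite /h; under eq_fun do rewrite -mulN1r; exact: bmeasurableZ.
have [x Wx hx] := concentrated_exists (cW k (ltnSn k)) bh.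
exists (fun i => if i == k then x else z i).
  move=> i; rewrite ltnS leq_eqVlt; case: eqP => [->//|_ /= ik]; exact: Wz.
have -> : \int[pi]_u ((\sum_(i < k.+1)
      (chi (u, if i == k :> nat then x else z i) - p i u)) ^+ 2) =
    \int[pi]_u F (u, x).
  apply: eq_Rintegral => u _; rewrite big_ord_recr/= eqxx /F; congr ((_ + _) ^+ 2).
  by apply: eq_bigr => i _; rewrite ltn_eqF.
have {}hx : \int[pi]_u F (u, x) <= n * \int[m k]_x \int[pi]_u F (u, x).
  rewrite -lerN2 (le_trans _ hx)// /h.
  under [in leRHS]eq_Rintegral do rewrite -mulN1r.
  by rewrite bRintegralZ// mulN1r mulrN.
apply: le_trans hx _; rewrite -bRintegral_swap// big_ord_recr/=.
rewrite -bRintegralZ; last exact: (bmeasurable_Rintegral pi (m k)).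
apply: le_trans (lerD IHz (lexx _)).
have bp2 : bmeasurable (fun u => p k u * (1 - p k u)).
  by apply: bmeasurableM => //; apply: bmeasurableB => //; exact: bmeasurable_cst.
have bS2 : bmeasurable (fun u => S u ^+ 2).
  by under eq_fun do rewrite expr2; exact: bmeasurableM.
rewrite -bRintegralD//; rewrite le_eqVlt; apply/orP; left; apply/eqP/eq_Rintegral => u _.
(* Since [chi ^+ 2 = chi], the square is affine in [chi]; averaging replaces [chi] by [p k u] and
   leaves [S u ^+ 2 + p k u * (1 - p k u)]. *)
have -> : \int[m k]_x F (u, x) =
    \int[m k]_x ((S u - p k u) ^+ 2 + (2 * (S u - p k u) + 1) * chi (u, x)).
  apply: eq_Rintegral => y _; rewrite /F/= mulrDl mul1r.
  by rewrite -[X in _ = _ + (_ + X)]chi2; ring.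
have [_ _ mT] := cW k (ltnSn k).
rewrite bRintegralD//; last 2 first.
  exact: bmeasurable_cst.
  exact: bmeasurableZ.
rewrite Rintegral_cst// (_ : fine _ = n^-1); last by rewrite [X in fine X]mT.
rewrite bRintegralZ//.
have -> : \int[m k]_x chi (u, x) = n^-1 * p k u.
  by rewrite /p mulrA mulVf ?gt_eqF// mul1r.
rewrite -/(S u); move: (S u) (p k u) => a b. by field; rewrite gt_eqF.
Qed.

End Selection.

(** * Equipartition of the cube *)

Section Slice.
Context d (T : measurableType d) (R : realType).
Variables (m : {finite_measure set T -> \bar R}) (X : T -> R).
Hypotheses (mX : measurable_fun [set: T] X)
  (X_null : forall c, m (X @^-1` [set c]) = 0%E).

Lemma measurable_sublevel c : measurable [set z | X z <= c].
Proof.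
rewrite (_ : mkset _ = X @^-1` `]-oo, c]).
  by rewrite -[X in measurable X]setTI; exact: mX.
by apply/seteqP; split => z /=; rewrite in_itv.
Qed.

Lemma measurable_strict_sublevel c : measurable [set z | X z < c].
Proof.
rewrite (_ : mkset _ = X @^-1` `]-oo, c[).
  by rewrite -[X in measurable X]setTI; exact: mX.
by apply/seteqP; split => z /=; rewrite in_itv.
Qed.

(** An intermediate value argument for the distribution function [g], with [s] the infimum of the
    levels where [g] reaches [v]. Continuity from above gives [v <= g s], continuity from below
    bounds the strict sublevel set by [v], and the null level set closes the gap. *)
Lemma exists_slice (S : set T) (a b : R) (v : \bar R) : measurable S ->
  (forall z, S z -> a <= X z <= b) -> a <= b -> (0 <= v <= m S)%E ->
  exists2 s, a <= s <= b & m (S `&` [set z | X z <= s]) = v.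
Proof.
move=> mS Sab ab /andP[v0 vS].
pose g x := m (S `&` [set z | X z <= x]).
have mg x : measurable (S `&` [set z | X z <= x]).
  by apply: measurableI => //; exact: measurable_sublevel.
have g_homo x y : x <= y -> (g x <= g y)%E.
  move=> xy; rewrite le_measure ?inE//; apply: setIS => z /= /le_trans; exact.
pose A := [set x | a <= x /\ (v <= g x)%E].
have Ab : A b.
  split=> //; rewrite (le_trans vS)// le_measure ?inE//.
  by move=> z Sz; split => //=; case/andP: (Sab _ Sz).
have lA : has_lbound A by exists a => x [].
have iA : has_inf A by split => //; exists b.
pose s := inf A.
have as_ : a <= s by apply: lb_le_inf; [exists b|move=> x []].
have sb : s <= b by exact: ge_inf.
exists s; first by rewrite as_ sb.
have inv0 n : 0 < n.+1%:R^-1 :> R by rewrite invr_gt0.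
apply/eqP; rewrite eq_le; apply/andP; split; last first.
  pose F n := S `&` [set z | X z <= s + n.+1%:R^-1].
  have FE : \bigcap_n F n = S `&` [set z | X z <= s].
    apply/seteqP; split => [z Fz|z [Sz /= zs] n _]; last first.
      by split => //=; rewrite (le_trans zs)// lerDl ltW.
    split; first by case: (Fz 0%N I).
    apply/ler_addgt0Pr => e e0; have [_ /= Fe] := Fz (Num.truncn e^-1) I.
    rewrite (le_trans Fe)// lerD2l invf_ple ?posrE// ltW//.
    by rewrite truncnS_gt.
  have cF : m (F n) @[n --> \oo] --> g s.
    rewrite /g -FE; apply: nonincreasing_cvg_mu.
    - by rewrite ltey_eq fin_num_measure//; exact: mg.
    - by move=> i; exact: mg.
    - by rewrite FE; exact: mg.
    - move=> i j ij; apply/subsetPset; apply: setIS => z /= /le_trans; apply.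
      by rewrite lerD2l lef_pV2 ?posrE// ler_nat.
  rewrite -/(g s) -(cvg_lim _ cF)//; apply: lime_ge; first exact: cvgP cF.
  apply: nearW => n; have [e [_ vge] es] := inf_adherent (inv0 n) iA.
  by rewrite (le_trans vge)//; apply: g_homo; exact: ltW.
pose F n := S `&` [set z | X z <= s - n.+1%:R^-1].
have FE : \bigcup_n F n = S `&` [set z | X z < s].
  apply/seteqP; split => [z [n _ [Sz /= zs]]|z [Sz /= zs]].
    by split => //=; rewrite (le_lt_trans zs)// gtrBl.
  have sz0 : 0 < s - X z by rewrite subr_gt0.
  exists (Num.truncn (s - X z)^-1) => //; split => //=.
  by rewrite lerBrDr -lerBrDl invf_ple ?posrE// ltW// truncnS_gt.
have mF : measurable (S `&` [set z | X z < s]).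
  by apply: measurableI => //; exact: measurable_strict_sublevel.
have cF : m (F n) @[n --> \oo] --> m (S `&` [set z | X z < s]).
  rewrite -FE; apply: nondecreasing_cvg_mu.
  - by move=> i; exact: mg.
  - by rewrite FE.
  - move=> i j ij; apply/subsetPset; apply: setIS => z /= /le_trans; apply.
    by rewrite lerD2l lerN2 lef_pV2 ?posrE// ler_nat.
have mv : (m (S `&` [set z | (X z < s)%R]) <= v)%E.
  rewrite -(cvg_lim _ cF)//; apply: lime_le; first exact: cvgP cF.
  apply: nearW => n; rewrite leNgt; apply/negP => vF.
  have xs : s - n.+1%:R^-1 < s by rewrite gtrBl.
  (* Minimality of [s] speaks only of levels at least [a]; below [a] the slice is empty. *)
  have [ax|xa] := leP a (s - n.+1%:R^-1).
    have /(ge_inf lA) : A (s - n.+1%:R^-1) by split => //; exact: ltW.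
    by rewrite leNgt xs.
  suff F0 : F n = set0 by move: vF; rewrite F0 measure0 ltNge v0.
  rewrite -subset0 => z [/Sab/andP[az _] /= zx].
  by have := le_lt_trans (le_trans az zx) xa; rewrite ltxx.
have -> : S `&` [set z | X z <= s] =
    (S `&` [set z | X z < s]) `|` (S `&` X @^-1` [set s]).
  rewrite -setIUr; congr (_ `&` _); apply/seteqP; split => z /=.
    by rewrite le_eqVlt => /predU1P[->|]; [right|left].
  by case=> [/ltW//|->].
have mXs : measurable (X @^-1` [set s]).
  by rewrite -[X in measurable X]setTI; exact: mX.
rewrite (le_trans (measureU2 _ _ _))//; first exact: measurableI.
rewrite [X in (_ + X)%E](_ : _ = 0%E); last first.
  by apply: subset_measure0 (X_null s) => //; exact: measurableI.
by rewrite adde0; exact: mv.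
Qed.
End Slice.

Lemma exists_nat_ceil (R : realType) (x : R) : 0 <= x ->
  exists c : nat, x <= c%:R < x + 1.
Proof.
move=> /Num.Theory.truncn_itv /andP[nx xn]; set n := Num.truncn x in nx xn.
have [->|xneq] := eqVneq x n%:R; first by exists n; rewrite lexx ltrDl ltr01.
exists n.+1; rewrite ltW//= -natr1 ltrD2r lt_neqAle eq_sym xneq.
exact: nx.
Qed.

Section Cut.
Context (R : realType) (d : nat).
Notation Z := (d.-tuple R).
Variables (tau : {finite_measure set Z -> \bar R}) (eps : R).
Hypotheses (eps_gt0 : 0 < eps)
  (tau_null : forall (k : 'I_d) c, tau [set z | tnth z k = c] = 0%E).
Implicit Types (S : set Z) (n c q : nat) (beta : 'I_d -> R).

(* [w i k] bounds the width of the piece [W i] in direction [k]; only the totals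
   over all pieces are kept in the type, as they add up under [cutU]. *)
Definition cut S n beta : Prop :=
  exists (W : nat -> set Z) (w : nat -> 'I_d -> R),
  [/\ forall i, (i < n)%N -> measurable (W i) /\ tau (W i) = eps%:E,
      S = \bigcup_(i < n) W i,
      trivIset `I_n W,
      forall i k z z', (i < n)%N -> W i z -> W i z' ->
        `|tnth z k - tnth z' k| <= w i k &
      forall k, \sum_(i < n) w i k <= beta k].

Lemma cut1 S (b : 'I_d -> R) : measurable S -> tau S = eps%:E ->
  (forall k z z', S z -> S z' -> `|tnth z k - tnth z' k| <= b k) -> cut S 1 b.
Proof.
move=> mS tS Sb; exists (fun=> S), (fun=> b); split => //.
- by apply/seteqP; split => [z Sz|z [] //]; exists 0%N.
- by move=> [|i] [|j].
- by move=> i k z z' _; exact: Sb.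
- by move=> k; rewrite big_ord1.
Qed.

Lemma cut_le S n beta beta' : (forall k, beta k <= beta' k) ->
  cut S n beta -> cut S n beta'.
Proof.
move=> le [W [w [? ? ? ? wb]]]; exists W, w; split => // k.
exact: le_trans (wb k) (le k).
Qed.

(** All [n] pieces lie in the slab, so its thickness bounds each of them in direction [k0], whatever
    [beta] was there. *)
Lemma cut_width S n beta k0 (a b : R) :
  (forall z, S z -> a <= tnth z k0 <= b) -> cut S n beta ->
  cut S n (fun k => if k == k0 then n%:R * (b - a) else beta k).
Proof.
move=> Sab [W [w [mW SW dW Ww wb]]].
exists W, (fun i k => if k == k0 then b - a else w i k); split => //.
  move=> i k z z' ik Wz Wz'; case: eqP => [->|_]; last exact: Ww.
  have /Sab/andP[? ?] : S z by rewrite SW; exists i.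
  have /Sab/andP[? ?] : S z' by rewrite SW; exists i.
  by rewrite ler_norml; apply/andP; split; lra.
move=> k; case: eqP => _ //.
by rewrite big_const_ord iter_addr_0 mulr_natl.
Qed.

Lemma cutU S1 S2 n1 n2 beta1 beta2 : S1 `&` S2 = set0 ->
  cut S1 n1 beta1 -> cut S2 n2 beta2 ->
  cut (S1 `|` S2) (n1 + n2) (fun k => beta1 k + beta2 k).
Proof.
move=> S12 [W1 [w1 [mW1 SW1 dW1 Ww1 wb1]]] [W2 [w2 [mW2 SW2 dW2 Ww2 wb2]]].
have lt2 i : (i < n1 + n2)%N -> (i < n1)%N = false -> (i - n1 < n2)%N.
  move=> i12 /negbT; rewrite -leqNgt => n1i.
  by rewrite ltn_subLR.
have W1S i z : (i < n1)%N -> W1 i z -> S1 z by rewrite SW1 => ? ?; exists i.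
have W2S i z : (i < n2)%N -> W2 i z -> S2 z by rewrite SW2 => ? ?; exists i.
have S12F z : S1 z -> S2 z -> False.
  by move=> ? ?; have : (S1 `&` S2) z by []; rewrite S12.
exists (fun i => if (i < n1)%N then W1 i else W2 (i - n1)%N),
  (fun i => if (i < n1)%N then w1 i else w2 (i - n1)%N); split.
- by move=> i i12; case: ifPn => [/mW1//|/negbTE/(lt2 _ i12)/mW2].
- apply/seteqP; split => z.
    move=> [|].
      rewrite {1}SW1 => -[i /= i1 Wz]; exists i => /=; last by rewrite i1.
      by rewrite (leq_trans i1)// leq_addr.
    rewrite {1}SW2 => -[i /= i2 Wz]; exists (n1 + i)%N => /=.
      by rewrite ltn_add2l.
    by rewrite ltnNge leq_addr/= addKn.
  move=> [i /= i12]; case: ifPn => [i1 /(W1S _ _ i1)|/negbTE i1]; first by left.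
  by move/(W2S _ _ (lt2 _ i12 i1)); right.
- move=> i j /= i12 j12; case: ifPn => i1; case: ifPn => j1 [z [Wi Wj]].
  + by apply: dW1 => //; exists z.
  + by case: (S12F z); [exact: W1S Wi|apply: W2S Wj; exact/lt2/negbTE].
  + by case: (S12F z); [exact: W1S Wj|apply: W2S Wi; exact/lt2/negbTE].
  + rewrite -leqNgt in i1; rewrite -leqNgt in j1.
    have lti : (i - n1 < n2)%N by rewrite ltn_subLR.
    have ltj : (j - n1 < n2)%N by rewrite ltn_subLR.
    rewrite -(subnKC i1) -[RHS](subnKC j1); congr addn.
    by apply: (dW2 _ _ lti ltj); exists z.
- move=> i k z z' i12; case: ifPn => [i1|/negbTE i1]; first exact: Ww1.
  exact/Ww2/lt2.
- move=> k; rewrite big_split_ord/=; apply: lerD.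
    by apply: le_trans (wb1 k); apply: ler_sum => i _; rewrite ltn_ord.
  apply: le_trans (wb2 k); apply: ler_sum => i _.
  by rewrite ltnNge leq_addr/= addKn.
Qed.

(** Slabs of exactly [c] pieces are cut off from the low side until at most [c] pieces are left. A
    slab of thickness [s - a] costs [c%:R * (s - a)] in direction [k0], and these costs telescope to
    [c%:R * (b - a)]; each of the at most [q] slabs costs [B] in the earlier directions. *)
Lemma cut_slabs (k0 : 'I_d) (B : R) c q S n (a b : R) : 0 <= B -> (0 < c)%N ->
  (forall S n, measurable S -> S `<=` @unit_cube R d -> tau S = (n%:R * eps)%:E ->
    (0 < n <= c)%N -> cut S n (fun k => if (k < k0)%N then B else n%:R)) ->
  measurable S -> S `<=` @unit_cube R d -> a <= b ->
  (forall z, S z -> a <= tnth z k0 <= b) ->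
  tau S = (n%:R * eps)%:E -> (0 < n <= q * c)%N ->
  cut S n (fun k => if (k < k0)%N then q%:R * B
                    else if k == k0 then c%:R * (b - a) else n%:R).
Proof.
move=> B0 c0 cutc; elim: q S n a => [|q IH] S n a mS Scube ab Sab tS.
  by rewrite mul0n => /andP[/leq_trans + n0] => /(_ _ n0).
move=> /andP[n0 nqc]; have [nc|cn] := leqP n c.
  apply: cut_le (cut_width Sab (cutc _ _ mS Scube tS _)); last by rewrite n0.
  move=> k; case: eqP => [->|_].
    by rewrite ltnn ler_wpM2r ?subr_ge0// ler_nat.
  case: ifP => // _; rewrite -natr1 mulrDl mul1r lerDr.
  by rewrite mulr_ge0.
have mX : measurable_fun [set: Z] ((@tnth d R)^~ k0) by exact: measurable_tnth.
have [|s /andP[as_ sb] ts] :=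
    exists_slice mX (tau_null k0) (v := (c%:R * eps)%:E) mS Sab ab.
  rewrite tS !lee_fin mulr_ge0 ?(ltW eps_gt0)//=.
  by rewrite ler_pM2r// ler_nat ltnW.
set S1 := S `&` _ in ts.
have mS1 : measurable S1.
  by apply: measurableI => //; exact: (measurable_sublevel mX).
pose S2 := S `\` S1.
have mS2 : measurable S2 by exact: measurableD.
have SE : S = S1 `|` S2.
  by rewrite /S2 setUDr ?setDv ?setD0 ?setUv// setUC setUidl// => z [].
have tS2 : tau S2 = ((n - c)%:R * eps)%:E.
  rewrite /S2 measureD//; last by rewrite ltey_eq fin_num_measure.
  rewrite (_ : S `&` S1 = S1); last by rewrite setIidr// => z [].
  rewrite [X in (X - _)%E]tS [X in (_ - X)%E]ts -EFinB -mulrBl natrB//.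
  exact: ltnW.
have S1cut : cut S1 c (fun k => if k == k0 then c%:R * (s - a)
    else if (k < k0)%N then B else c%:R).
  apply: cut_width; first by move=> z [/Sab/andP[-> _]].
  by apply: cutc => //; [by move=> z [/Scube]|rewrite c0 leqnn].
have S2cut : cut S2 (n - c) (fun k => if (k < k0)%N then q%:R * B
    else if k == k0 then c%:R * (b - s) else (n - c)%:R).
  apply: IH => //.
  - by move=> z [/Scube].
  - move=> z [Sz /not_andP[//|/negP]]; rewrite -ltNge => /ltW ->.
    by case/andP: (Sab _ Sz).
  - by rewrite subn_gt0 cn leq_subLR -mulSn.
rewrite SE -(subnKC (ltnW cn)).
apply: cut_le (cutU _ S1cut S2cut); last by rewrite /S2 setDIK.
move=> k; case: eqP => [->|/eqP kk]; first by rewrite ltnn -mulrDr; lra.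
case: ifP => _; first by rewrite -natr1 mulrDl mul1r addrC.
by rewrite natrD.
Qed.

(* [n < t ^ j + 1] is the integer-valued form of [n <= ceil (t ^ j)]. Slabs of
   [ceil (t ^ j)] pieces each are enough since
   [ceil (t ^ j.+1) <= ceil t * ceil (t ^ j)], and each rounding up costs at most
   a factor 2; the directions [k >= j] only carry the trivial bound [n]. *)
Lemma cut_coords (t : R) (j : nat) : 1 <= t -> (j <= d)%N ->
  forall S n, measurable S -> S `<=` @unit_cube R d ->
  tau S = (n%:R * eps)%:E -> (0 < n)%N -> n%:R < t ^+ j + 1 ->
  cut S n (fun k => if (k < j)%N then (2 * t) ^+ j.-1 else n%:R).
Proof.
move=> t1; have t0 : 0 <= t by apply: le_trans t1.
elim: j => [|j IH] jd S n mS Scube tS n0 nt.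
  (* Here [n < 2], so there is a single piece, and the side 1 of the cube bounds its widths. *)
  have n1 : n = 1%N.
    apply/eqP; rewrite eqn_leq n0 andbT -ltnS -(ltr_nat R).
    by apply: lt_le_trans nt _; rewrite expr0 -natr1.
  move: tS; rewrite n1 mul1r => tS; apply: cut1 => // k z z' Sz Sz'.
  have /andP[? ?] := Scube _ Sz k; have /andP[? ?] := Scube _ Sz' k.
  by rewrite ler_norml; apply/andP; split; lra.
have [c /andP[tc ct]] := exists_nat_ceil (exprn_ge0 j t0).
have [q /andP[tq qt]] := exists_nat_ceil t0.
have tj1 : 1 <= t ^+ j by exact: exprn_ege1.
have c0 : (0 < c)%N by rewrite -(ltr_nat R) (lt_le_trans ltr01)// (le_trans tj1).
have nqc : (n <= q * c)%N.
  rewrite -ltnS -(ltr_nat R) (lt_le_trans nt)// -natr1 natrM lerD2r exprS.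
  by rewrite ler_pM ?exprn_ge0.
have q0 : (q == 0)%N = false.
  by apply/negbTE/eqP => q0; move: tq; rewrite q0 leNgt (lt_le_trans ltr01).
pose k0 : 'I_d := Ordinal jd.
have Sk0 z : S z -> 0 <= tnth z k0 <= 1 by move=> /Scube.
have B0 : 0 <= (2 * t) ^+ j.-1 by rewrite exprn_ge0// mulr_ge0.
have := @cut_slabs k0 _ c q S n 0 1 B0 c0 _ mS Scube ler01 Sk0 tS.
rewrite n0 nqc subr0 mulr1 => H; apply: cut_le (H _ isT) => [k|S' n' mS' cS' tS'].
  rewrite ltnS [(k <= j)%N]leq_eqVlt -val_eqE/=; case: (ltngtP k j) => //= kj.
    (* Earlier directions gain a factor [q], which is at most [2 * t] because [q < t + 1] and
       [1 <= t]. *)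
    have j0 : (0 < j)%N by exact: leq_ltn_trans kj.
    by rewrite -[in leRHS](prednK j0) exprS ler_wpM2r//; lra.
  (* For [0 < j], [c < t ^+ j + 1 <= 2 * t ^+ j] is at most [(2 * t) ^+ j]. For [j = 0] the integer
     [c < 2] is at most 1 and no factor 2 is spent: hence the exponent [j.-1], and 2^(d-1) in the
     end. *)
  have [j0|j0] := posnP j; last first.
    rewrite exprMn; apply: (le_trans (ltW ct)).
    apply: (@le_trans _ _ (2 * t ^+ j)); first by lra.
    rewrite ler_wpM2r ?exprn_ge0// -[leLHS]expr1 ler_weXn2l// ler1n.
    by [].
  move: ct; rewrite j0 !expr0 => ct.
  by rewrite -[leRHS]/(1%:R) ler_nat -ltnS -(ltr_nat R) -natr1.
move=> /andP[n'0 n'c]; apply: IH => //; first exact: ltnW.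
by apply: le_lt_trans ct; rewrite ler_nat.
Qed.

End Cut.

Lemma eucl_dist_le_sum (R : realType) (d : nat) (z z' : d.-tuple R) :
  eucl_dist z z' <= \sum_k `|tnth z k - tnth z' k|.
Proof.
set s := \sum_k _; have s0 : 0 <= s by exact: sumr_ge0.
rewrite /eucl_dist -[leRHS](ger0_norm s0) -sqrtr_sqr ler_sqrt; last exact: exprn_ge0.
rewrite [leRHS]expr2 {1}/s mulr_suml; apply: ler_sum => k _.
rewrite -[leLHS]ger0_norm ?sqr_ge0// expr2 normrM ler_wpM2l// /s (bigD1 k)//= lerDl.
exact: sumr_ge0.
Qed.

(** The choice t = N^(1/d) makes n = N admissible for the cut in all [d] directions. Each direction
    has total width at most (2t)^(d-1) = 2^(d-1) N^(1-1/d), and a Euclidean diameter is at most the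
    sum of the [d] widths. *)
Lemma exists_equipartition (R : realType) (d N : nat)
    (tau : {finite_measure set (d.-tuple R) -> \bar R}) (S : set (d.-tuple R)) :
  (0 < d)%N -> (0 < N)%N ->
  (forall (k : 'I_d) c, tau [set z | tnth z k = c] = 0%E) ->
  measurable S -> S `<=` @unit_cube R d -> tau S = 1%E ->
  exists (W : nat -> set (d.-tuple R)) (D : nat -> R),
  [/\ forall i, (i < N)%N -> measurable (W i) /\ tau (W i) = (N%:R^-1)%:E,
      S = \bigcup_(i < N) W i,
      trivIset `I_N W,
      forall i z z', (i < N)%N -> W i z -> W i z' -> eucl_dist z z' <= D i &
      \sum_(i < N) D i <= d%:R * 2 ^+ d.-1 * N%:R `^ (1 - d%:R^-1)].
Proof.
move=> d0 N0 tau0 mS Scube tS.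
have NR0 : 0 < N%:R :> R by rewrite ltr0n.
have dR0 : d%:R != 0 :> R by rewrite pnatr_eq0 -lt0n.
pose t : R := N%:R `^ d%:R^-1.
have t1 : 1 <= t by rewrite -(powRr0 N%:R) ler_powR ?ler1n// invr_ge0.
have td : t ^+ d = N%:R by rewrite -powR_mulrn ?powR_ge0// -powRrM mulVf// powRr1.
have tS' : tau S = (N%:R * N%:R^-1)%:E by rewrite mulfV ?gt_eqF.
have Nlt : N%:R < t ^+ d + 1 by rewrite td ltrDl.
have Ninv : 0 < N%:R^-1 :> R by rewrite invr_gt0.
have [W [w [mW SW dW Ww wb]]] := cut_coords Ninv tau0 t1 (leqnn d) mS Scube tS' N0 Nlt.
exists W, (fun i => \sum_k w i k); split => //.
  move=> i z z' iN Wz Wz'.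
  apply: (@le_trans _ _ (\sum_k `|tnth z k - tnth z' k|)); last first.
    by apply: ler_sum => k _; exact: Ww.
  exact: eucl_dist_le_sum.
rewrite exchange_big/= (le_trans (ler_sum _ (fun k _ => wb k)))//.
under eq_bigr do rewrite ltn_ord.
rewrite sumr_const card_ord exprMn -[leLHS]mulr_natl -mulrA ler_wpM2l//.
rewrite ler_wpM2l ?exprn_ge0//.
rewrite -powR_mulrn ?powR_ge0// -powRrM -subn1 natrB// mulrBr mulVf// mulr1.
by [].
Qed.

(** * Parametrization of a rectifiable space *)

Section LebesgueTupleFacts.
Context (R : realType).

Lemma measurable_unit_cube n : measurable (@unit_cube R n).
Proof.
rewrite (_ : @unit_cube R n = \bigcap_(k in [set: 'I_n])
    ((@tnth n R)^~ k @^-1` `[0, 1])).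
  apply: fin_bigcap_measurable => // k _.
  by rewrite -[X in measurable X]setTI; exact: measurable_tnth.
apply/seteqP; split => z Hz k; first by rewrite /= in_itv/=.
by have := Hz k I; rewrite /= in_itv.
Qed.

(** [C] is described through its preimage because the measure is a pushforward along
    [tuple_cons]. *)
Lemma lebesgue_tuple_setX n (A : set R) (B : set (n.-tuple R)) C :
  measurable A -> measurable B -> @tuple_cons R n @^-1` C = A `*` B ->
  lebesgue_tuple n.+1 C = (lebesgue_measure A * lebesgue_tuple n B)%E.
Proof.
move=> mA mB CE; rewrite -[LHS]/((lebesgue_measure \x^ lebesgue_tuple n)%E _).
by rewrite CE product_measure2E.
Qed.

Lemma lebesgue_tuple_hyperplane n (k : 'I_n) c :
  lebesgue_tuple n [set z : n.-tuple R | tnth z k = c] = 0%E.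
Proof.
elim: n k => [[]//|n IH] k.
have [j ->|->] := unliftP ord0 k.
  rewrite (@lebesgue_tuple_setX _ setT [set z | tnth z j = c])//.
  - by rewrite IH mule0.
  - rewrite (_ : mkset _ = (@tnth n R)^~ j @^-1` [set c])//.
    by rewrite -[X in measurable X]setTI; exact: measurable_tnth.
  - by apply/seteqP; split => -[x z] /=; rewrite tnthS //; case.
rewrite (@lebesgue_tuple_setX _ [set c] setT)//.
  by rewrite lebesgue_measure_set1 mul0e.
by apply/seteqP; split => -[x z] /=; rewrite tnth0 //; case.
Qed.

Lemma lebesgue_tuple_unit_cube n : lebesgue_tuple n (@unit_cube R n) = 1%E.
Proof.
elim: n => [|n IH].
  by rewrite /= diracE mem_set// => -[].
rewrite (@lebesgue_tuple_setX _ `[0, 1]%classic (@unit_cube R n))//; last 2 first.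
- exact: measurable_unit_cube.
- apply/seteqP; split => -[x z] /=.
    move=> H; split => [|i]; first by have := H ord0; rewrite tnth0 in_itv.
    by have := H (lift ord0 i); rewrite tnthS.
  rewrite in_itv => -[x01 z01] i; have [j ->|->] := unliftP ord0 i.
    by rewrite tnthS; exact: z01.
  by rewrite tnth0.
by rewrite IH mule1 lebesgue_measure_itv/= lte_fin ltr01 oppr0 adde0.
Qed.

End LebesgueTupleFacts.

Section OuterMeasure.
Context d (T : measurableType d) (R : realType).
Variable mu : {measure set T -> \bar R}.
Local Notation "mu^*" := (mu^*)%mu.

Lemma exists_measurable_hull A : (mu^* A < +oo)%E ->
  exists2 B, measurable B /\ A `<=` B & mu B = mu^* A.
Proof.
move=> Afin; have A0 : (0 <= mu^* A)%E by exact: mu_ext_ge0.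
have Afn : mu^* A \is a fin_num by rewrite ge0_fin_numE.
have H n : exists B, [/\ measurable B, A `<=` B &
    (mu B <= mu^* A + (n.+1%:R^-1)%:E)%E].
  have [//|x [F [mF AF] <-] Fx] := @lb_ereal_inf_adherent _ _ n.+1%:R^-1 _ Afn.
  exists (\bigcup_k F k); split => //; first exact: bigcupT_measurable.
  rewrite (le_trans _ (ltW Fx))//; apply: measure_sigma_subadditive => //.
  exact: bigcupT_measurable.
have [B HB] := choice H.
have mB : measurable (\bigcap_n B n).
  by apply: bigcapT_measurable => n; case: (HB n).
have AB : A `<=` \bigcap_n B n by move=> z Az n _; case: (HB n) => _ + _; exact.
exists (\bigcap_n B n) => //; apply/eqP; rewrite eq_le; apply/andP; split.
  apply/lee_addgt0Pr => e e0.
  have [mBn _ Bn] := HB (Num.truncn e^-1).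
  apply: (@le_trans _ _ (mu (B (Num.truncn e^-1)))).
    by rewrite le_measure ?inE// => z; exact.
  rewrite (le_trans Bn)// leeD2l// lee_fin invf_ple ?posrE// ltW//.
  by rewrite truncnS_gt.
by rewrite -measurable_mu_extE//; exact: le_mu_ext.
Qed.

(** The kernel is the complement in [Q] of a hull [H] of [C], the part of [Q] outside [A]. The
    Caratheodory condition of [A], tested on [H], which has the same finite outer measure as [C],
    shows that [A] meets [H] in a null set; [N] is a hull of that set. *)
Lemma exists_measurable_kernel (Q A : set T) : measurable Q -> (mu Q < +oo)%E ->
  A `<=` Q -> mu^*.-cara.-measurable A ->
  exists B N, [/\ measurable B, B `<=` A, measurable N, mu N = 0%E &
    A `\` B `<=` N].
Proof.
move=> mQ Qfin AQ cA; pose C := Q `\` A.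
have Cfin : (mu^* C < +oo)%E.
  apply: le_lt_trans Qfin; rewrite -measurable_mu_extE//.
  by apply: le_mu_ext => z [].
have [H0 [mH0 CH0] H0E] := exists_measurable_hull Cfin.
pose H := H0 `&` Q.
have mH : measurable H by exact: measurableI.
have CH : C `<=` H by move=> z Cz; split; [exact: CH0|case: Cz].
have HE : mu^* H = mu^* C.
  apply/eqP; rewrite eq_le; apply/andP; split; last exact: le_mu_ext.
  rewrite -H0E measurable_mu_extE// le_measure ?inE//.
  by move=> z [].
have HA0 : mu^* (H `&` A) = 0%E.
  have : mu^* H = (mu^* (H `&` A) + mu^* (H `&` ~` A))%E by exact: cA.
  rewrite (_ : H `&` ~` A = C); last first.
    by apply/seteqP; split => z [Hz Az]; split => //; [case: Hz|apply: CH].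
  have Cfn : mu^* C \is a fin_num by rewrite ge0_fin_numE ?mu_ext_ge0.
  by rewrite HE => /(congr1 (fun x => x - mu^* C)%E); rewrite subee// addeK.
have [|N [mN HN] N0] := @exists_measurable_hull (H `&` A); first by rewrite HA0.
exists (Q `\` H), N; split => //.
- exact: measurableD.
- move=> z [Qz Hz]; apply: contrapT => Az; apply: Hz; exact: CH.
- by rewrite N0.
- move=> z [Az QHz]; apply: HN; split => //; apply: contrapT => Hz.
  by apply: QHz; split => //; exact: AQ.
Qed.

End OuterMeasure.

Lemma eucl_dist_ge0 (R : realType) n (z z' : n.-tuple R) : 0 <= eucl_dist z z'.
Proof. exact: sqrtr_ge0. Qed.

(** Measurability on tuples is reached through coordinates, so the preimage of an open set is
    written, within [A], as a countable union of grid cubes: by the Lipschitz bound, a fine enough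
    cube around a point of the preimage is mapped into the open set. *)
Lemma measurable_fun_lipschitz (R : realType) (M : pmetricType R) n
    (A : set (n.-tuple R)) (f : n.-tuple R -> M) :
  measurable A -> lipschitz_bounds A f !=set0 ->
  measurable_fun A (f : n.-tuple R -> borel M).
Proof.
move=> mA [L0 HL0]; pose L := `|L0| + 1.
have L_gt0 : 0 < L by rewrite ltr_wpDl.
have HL z z' : A z -> A z' -> mdist (f z) (f z') <= L * eucl_dist z z'.
  move=> Az Az'; rewrite (le_trans (HL0 _ _ Az Az'))// ler_wpM2r ?eucl_dist_ge0//.
  by rewrite (le_trans (ler_norm _))// lerDl.
pose cell (i : nat * n.-tuple int) : set (n.-tuple R) :=
  \bigcap_(k in [set: 'I_n])
    ((@tnth n R)^~ k @^-1` `[(tnth i.2 k)%:~R / i.1.+1%:R, ((tnth i.2 k)%:~R + 1) / i.1.+1%:R]).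
have mcell i : measurable (cell i).
  apply: fin_bigcap_measurable => // k _.
  by rewrite -[X in measurable X]setTI; exact: measurable_tnth.
have celldist i z z' : cell i z -> cell i z' -> eucl_dist z z' <= n%:R / i.1.+1%:R.
  move=> iz iz'; apply: (le_trans (eucl_dist_le_sum _ _)).
  rewrite mulr_natl -[X in _ *+ X](card_ord n) -sumr_const; apply: ler_sum => k _.
  have := iz k I; have := iz' k I; rewrite /= !in_itv/= mulrDl mul1r.
  set a := _%:~R / _; set b := _^-1 => /andP[? ?] /andP[? ?].
  by rewrite ler_norml; apply/andP; split; lra.
apply: (@measurability _ _ _ (borel M) A f (@open M) erefl) => _ [U oU <-].
rewrite (_ : A `&` _ = A `&` \bigcup_i (if `[< A `&` cell i `<=` f @^-1` U >]
    then cell i else set0)).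
  apply: measurableI => //; apply: countable_bigcupT_measurable => [|i].
    exact: countableP.
  by case: ifP.
apply/seteqP; split => z [Az]; last first.
  by move=> [i _]; case: ifPn => //= /asboolP H iz; split => //; exact: H.
move=> fzU; split => //.
have [e /= e0 eU] : nbhs_ball (f z) U by rewrite nbhs_ballE; exact: open_nbhs_nbhs.
(* Cells of this level have diameter at most n/(N+1), and L n/(N+1) < e. *)
pose N := Num.truncn (L * n%:R / e).
exists (N, [tuple Num.floor (tnth z k * N.+1%:R) | k < n]) => //.
set i := (N, _).
have iz : cell i z.
  move=> k _; rewrite /= in_itv/= tnth_mktuple.
  rewrite ler_pdivrMr// ler_pdivlMr//.
  have /andP[-> /ltW] := floor_itv (tnth z k * N.+1%:R).
  by rewrite intrD.
rewrite asboolT // => z' [Az' iz']; apply: eU; rewrite ballEmdist/=.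
apply: (le_lt_trans (HL _ _ Az Az')).
apply: (@le_lt_trans _ _ (L * (n%:R / N.+1%:R))).
  by rewrite ler_pM2l// (celldist i).
by rewrite mulrA ltr_pdivrMr// [ltRHS]mulrC -ltr_pdivrMr// truncnS_gt.
Qed.

(** [O] is measurable only for the completion, and [f] is controlled only on [O]. A measurable [S]
    exhausts [O] up to a Lebesgue-null set, which is [nu]-null by absolute continuity; [tau] is the
    restriction of [nu] to [S]. *)
Lemma rectification_param (R : realType) (M : pmetricType R)
    (mu : probability (borel M) R) d
    (nu : {finite_measure set (d.-tuple R) -> \bar R})
    (O : set (d.-tuple R)) (f : d.-tuple R -> M) :
  rectification mu nu O f ->
  exists (tau : {finite_measure set (d.-tuple R) -> \bar R})
    (phi : d.-tuple R -> borel M) (S : set (d.-tuple R)),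
  [/\ [/\ measurable S, S `<=` @unit_cube R d & S `<=` O],
      tau S = 1%E /\ tau (~` S) = 0%E,
      forall (k : 'I_d) c, tau [set z | tnth z k = c] = 0%E,
      measurable_fun [set: d.-tuple R] phi /\ (forall z, S z -> phi z = f z) &
      forall E : set (borel M), measurable E -> mu E = tau (phi @^-1` E)].
Proof.
move=> [[_ nuleb] [Ocube Ocara] [_ Olip] _ muE].
have cube_fin : (lebesgue_tuple d (@unit_cube R d) < +oo)%E.
  by rewrite lebesgue_tuple_unit_cube ltry.
have [S [N [mS SO mN N0 OSN]]] :=
  exists_measurable_kernel (@measurable_unit_cube R d) cube_fin Ocube Ocara.
have nuN0 : nu N = 0%E.
  apply: (nuleb N) => //; exact/measure0_null_setP.
have Sfin : (nu S < +oo)%E by rewrite ltey_eq fin_num_measure.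
(* Outside [S], where [tau] will have no mass, the map takes the default value [point]. *)
pose phi := (f : d.-tuple R -> borel M) \_ S.
have mf : measurable_fun S (f : d.-tuple R -> borel M).
  apply: measurable_fun_lipschitz => //; case: Olip => c Hc; exists c => z z' Sz Sz'.
  by apply: Hc; exact: SO.
have muphi (E : set (borel M)) : measurable E -> mu E = nu (S `&` f @^-1` E).
  move=> mE; rewrite -(measurable_mu_extE mu mE).
  rewrite muE; last exact: caratheodory_measurable_mu_ext.
  rewrite (_ : O `&` _ = O `&` f @^-1` E); last first.
    by apply/seteqP; split => z [Oz]; [case|move=> Ez; split => //; split => //; exists z].
  have mSE : measurable (S `&` f @^-1` E) by exact: mf.
  rewrite -(measurable_mu_extE nu mSE).
  apply/eqP; rewrite eq_le; apply/andP; split; last first.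
    by apply: le_mu_ext => z [/SO].
  apply: (@le_trans _ _ ((nu^*)%mu ((S `&` f @^-1` E) `|` N))).
    apply: le_mu_ext => z [Oz Ez]; have [Sz|Sz] := pselect (S z); first by left.
    by right; apply: OSN.
  apply: (le_trans (outer_measureU2 _ _ _)).
  rewrite [X in (_ + X)%E](_ : _ = 0%E) ?adde0//.
  by rewrite -nuN0; exact: measurable_mu_extE.
have phiS (A : set (borel M)) : S `&` phi @^-1` A = S `&` f @^-1` A.
  by apply/seteqP; split => z [Sz]; rewrite /phi /= patchE mem_set.
exists (mfrestr mS Sfin), phi, S; split.
- by split => //; exact: subset_trans SO Ocube.
- split; rewrite /= /mfrestr /mrestr/=; last by rewrite setICl measure0.
  rewrite setIid.
  by rewrite -[S]setIT -(preimage_setT f) -muphi ?probability_setT.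
- move=> k c; rewrite /= /mfrestr /mrestr/=.
  have mk : measurable [set z : d.-tuple R | tnth z k = c].
    rewrite (_ : mkset _ = (@tnth d R)^~ k @^-1` [set c])//.
    by rewrite -[X in measurable X]setTI; exact: measurable_tnth.
  apply: (@subset_measure0 _ _ _ nu _ [set z | tnth z k = c]) => //.
  - by apply: measurableI.
  - apply: (nuleb [set z | tnth z k = c]) => //; apply/measure0_null_setP => //.
    exact: lebesgue_tuple_hyperplane.
- split; last by move=> z Sz; rewrite /phi patchE mem_set.
  exact: (measurable_restrictT _ mS).1 mf.
- by move=> E mE; rewrite /= /mfrestr /mrestr/= setIC phiS; exact: muphi.
Qed.

(** * Measurability on compact metric spaces *)

Section MetricSpace.
Context (R : realType) (M : pmetricType R).
Hypothesis hM : compact [set: M].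

Lemma is_metric_mdist : is_metric (@mdist R M).
Proof.
split=> [||x y|x y z]; [exact: mdist_ge0| |exact: metric_sym|exact: metric_triangle].
by move=> x y; split => [/mdist_positivity//|->]; exact: mdistxx.
Qed.

(** Continuity of [rho] is not assumed: domination by the distance, combined with the triangle
    inequality of [rho] itself, supplies it in both arguments. With constant 1 this covers the
    distance too. *)
Lemma metric_kernel_lipschitz (rho : M -> M -> R) (c0 : R) :
  is_metric rho -> (forall x y, rho x y <= c0 * mdist x y) ->
  forall x y x' y', rho x y <= rho x' y' + c0 * (mdist x x' + mdist y y').
Proof.
move=> [_ _ sym tri] le x y x' y'.
have := tri x x' y; have := tri x' y' y; have := le x x'; have := le y y'.
by rewrite (sym y' y); lra.
Qed.

Lemma radii_image :
  radii M = (fun p : M * M => mdist p.1 p.2) @` [set: M * M].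
Proof.
by apply/seteqP; split => [r [x [y ->]]|r [[x y] _ <-]]; [exists (x, y)|exists x, y].
Qed.

Lemma continuous_mdist : continuous (fun p : M * M => mdist p.1 p.2).
Proof.
move=> [x y]; apply/cvgrPdist_lt => e e0.
have e2 : 0 < e / 2 by rewrite divr_gt0.
exists (ball x (e / 2), ball y (e / 2)) => /=.
  by split; exact: nbhsx_ballx.
move=> [x' y'] /= []; rewrite !ballEmdist /= => xx' yy'.
have le1 (u v : M) : mdist u v <= 1 * mdist u v by rewrite mul1r.
have := metric_kernel_lipschitz is_metric_mdist le1 x y x' y'.
have := metric_kernel_lipschitz is_metric_mdist le1 x' y' x y.
rewrite (metric_sym x' x) (metric_sym y' y) => h1 h2.
by rewrite ltr_norml; apply/andP; split; lra.
Qed.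

Lemma compact_radii : compact (radii M).
Proof.
rewrite radii_image; apply: continuous_compact.
  by apply: continuous_subspaceT => p; exact: continuous_mdist.
by rewrite -setXTT; exact: compact_setX.
Qed.

Lemma closed_radii : closed (radii M).
Proof. by apply: compact_closed compact_radii; exact: Rhausdorff. Qed.

Lemma mdist_bounded : exists C, forall x y : M, mdist x y <= C.
Proof.
have [C [_ HC]] := compact_bounded compact_radii.
exists (C + 1) => x y; apply: (le_trans (ler_norm _)).
by apply: (HC (C + 1)); [rewrite ltrDl|exists x, y].
Qed.

(** Compactness gives a finite cover for each mesh; interiors make the cells open. Indices past the
    end of the list give a ball around [point], which is just as small. *)
Lemma countable_open_cells : exists C : nat -> nat -> set M,
  [/\ forall n i, open (C n i),
      forall n x, exists i, C n i x &
      forall n i x y, C n i x -> C n i y -> mdist x y < 2 / n.+1%:R].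
Proof.
pose B n x := (ball x (n.+1%:R^-1 : R))^° : set M.
have H n : exists s : seq M, forall x, exists i, B n (nth point s i) x.
  have := hM; rewrite compact_cover => /(_ M [set: M] (B n)) [].
  - by move=> i _; exact: open_interior.
  - move=> x _; exists x => //; apply: nbhs_singleton.
    by apply: nbhs_interior; apply: nbhsx_ballx; rewrite invr_gt0.
  move=> D _ DT; exists (enum_fset D) => x.
  have [y /= yD By] := DT x I.
  by exists (index y (enum_fset D)); rewrite nth_index.
have [s Hs] := choice H.
exists (fun n i => B n (nth point (s n) i)); split => //.
- by move=> n i; exact: open_interior.
- move=> n i x y /interior_subset + /interior_subset.
  rewrite !ballEmdist /= => ix iy.
  apply: (le_lt_trans (metric_triangle _ (nth point (s n) i) _)).
  by rewrite metric_sym mulr_natl mulr2n ltrD.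
Qed.

Lemma measurable_open_borel (U : set M) : open U -> measurable (U : set (borel M)).
Proof. by move=> oU; exact: sub_sigma_algebra. Qed.

(** Joint measurability refers to the product of two Borel sigma-algebras, so a strict sublevel set
    has to be exhausted by countably many open rectangles; the cells provide them. *)
Lemma measurable_fun_metric_kernel (rho : M -> M -> R) (c0 : R) :
  0 < c0 -> is_metric rho -> (forall x y, rho x y <= c0 * mdist x y) ->
  measurable_fun [set: borel M * borel M] (fun p => rho p.1 p.2).
Proof.
move=> c0_gt0 mrho lerho.
have lip := metric_kernel_lipschitz mrho lerho.
have [C [oC cC dC]] := countable_open_cells.
apply: (measurability _ (RGenInftyO.measurableE R)) => _ [_ [c ->] <-].
rewrite setTI.
pose cell (i : nat * nat * nat) : set (borel M * borel M) :=
  C i.1.1 i.1.2 `*` C i.1.1 i.2.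
have mcell i : measurable (cell i).
  by apply: measurableX; exact: measurable_open_borel.
rewrite (_ : _ @^-1` _ = \bigcup_i
    (if `[< cell i `<=` [set p | rho p.1 p.2 < c] >] then cell i else set0)).
  apply: countable_bigcupT_measurable => [|i]; first exact: countableP.
  by case: ifP.
apply/seteqP; split => [[x y]|[x y] [i _]]; last first.
  by case: ifPn => // /asboolP H /H /=; rewrite in_itv.
rewrite /= in_itv/= => xyc.
(* Each argument moves by less than 2/(n+1) inside a cell, so [rho] grows by less than 4
   c0/(n+1). *)
pose n := Num.truncn (4 * c0 / (c - rho x y)).
have cxy : 0 < c - rho x y by rewrite subr_gt0.
have nlt : 4 * c0 / n.+1%:R < c - rho x y.
  by rewrite ltr_pdivrMr// [ltRHS]mulrC -ltr_pdivrMr// truncnS_gt.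
have [i Cix] := cC n x; have [j Cjy] := cC n y.
exists (n, i, j) => //; rewrite asboolT//= => -[x' y'] /= [Cix' Cjy'].
have h := lip x' y' x y; have := dC _ _ _ _ Cix' Cix; have := dC _ _ _ _ Cjy' Cjy.
move=> h1 h2; apply: le_lt_trans h _.
suff : c0 * (mdist x' x + mdist y' y) < c - rho x y by lra.
apply: le_lt_trans nlt; rewrite [4 * c0]mulrC -mulrA ler_pM2l//.
have -> : 4 = 2 + 2 :> R by rewrite -natrD.
by rewrite mulrDl ltW// ltrD.
Qed.

End MetricSpace.

(** * Transport from the cube and pieces of equal measure *)

Lemma ge0_integral_transport d1 d2 (T1 : measurableType d1)
    (T2 : measurableType d2) (R : realType)
    (m1 : {measure set T1 -> \bar R}) (m2 : {measure set T2 -> \bar R})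
    (phi : T1 -> T2) (F : T2 -> \bar R) :
  measurable_fun [set: T1] phi ->
  (forall E, measurable E -> m2 E = m1 (phi @^-1` E)) ->
  measurable_fun [set: T2] F -> (forall x, 0 <= F x)%E ->
  (\int[m2]_x F x = \int[m1]_z F (phi z))%E.
Proof.
move=> mphi m2E mF F0; rewrite (eq_measure_integral (pushforward m1 phi)).
  by rewrite ge0_integral_pushforward.
by move=> A mA _; exact: m2E.
Qed.

Section Lipschitz.
Context (R : realType) (M : pmetricType R) (d : nat).
Variables (O : set (d.-tuple R)) (f : d.-tuple R -> M).
Hypothesis Olip : lipschitz_bounds O f !=set0.

(** The infimum of the Lipschitz bounds is again one: a positive distance can be divided out, and at
    distance zero any single bound suffices. *)
Lemma mdist_Lip z z' : O z -> O z' ->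
  mdist (f z) (f z') <= Lip O f * eucl_dist z z'.
Proof.
move=> Oz Oz'; have [c Hc] := Olip.
have := eucl_dist_ge0 z z'; rewrite le_eqVlt => /predU1P[zz|zz].
  by have := Hc _ _ Oz Oz'; rewrite -zz !mulr0.
rewrite -ler_pdivrMr//; apply: lb_le_inf => // c' Hc'.
by rewrite ler_pdivrMr//; exact: Hc'.
Qed.

Lemma Lip_ge0 z z' (k : 'I_d) : O z -> O z' -> tnth z k != tnth z' k ->
  0 <= Lip O f.
Proof.
move=> Oz Oz' zz'; have e0 : 0 < eucl_dist z z'.
  rewrite sqrtr_gt0 (bigD1 k)//= ltr_pwDl ?sumr_ge0// => [|i _].
    by rewrite exprn_even_gt0//= subr_eq0.
  by rewrite sqr_ge0.
by rewrite -(pmulr_lge0 _ e0) (le_trans _ (mdist_Lip Oz Oz'))// mdist_ge0.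
Qed.

End Lipschitz.

(** A restriction depends on a proof of measurability; the existential form lets [choice] produce a
    whole family of them. *)
Lemma exists_mrestr d (T : measurableType d) (R : realType)
    (tau : {finite_measure set T -> \bar R}) (W : set T) : measurable W ->
  exists m : {finite_measure set T -> \bar R}, forall A, m A = tau (A `&` W).
Proof.
move=> mW; have Wfin : (tau W < +oo)%E by rewrite ltey_eq fin_num_measure.
by exists (mfrestr mW Wfin).
Qed.

Lemma bRintegral_transport d1 d2 (T1 : measurableType d1)
    (T2 : measurableType d2) (R : realType)
    (m1 : {finite_measure set T1 -> \bar R})
    (m2 : {finite_measure set T2 -> \bar R}) (phi : T1 -> T2) (h : T2 -> R) :
  measurable_fun [set: T1] phi ->
  (forall E, measurable E -> m2 E = m1 (phi @^-1` E)) ->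
  bmeasurable h -> \int[m2]_x h x = \int[m1]_z h (phi z).
Proof.
move=> mphi m2E bh; have bhphi := bmeasurable_comp mphi bh.
have pos g : bmeasurable g -> (forall x, 0 <= g x) ->
    \int[m2]_x g x = \int[m1]_z g (phi z).
  move=> [mg _] g0; congr fine.
  apply: (@ge0_integral_transport _ _ _ _ _ _ _ phi (EFin \o g)) => //.
  exact/measurable_EFinP.
have [_ [C hC]] := bh.
have bC2 := bmeasurable_cst T2 C; have bC1 := bmeasurable_cst T1 C.
have Ch0 x : 0 <= C + h x.
  by rewrite -lerBlDl sub0r; have := hC x; rewrite ler_norml => /andP[].
have := pos _ (bmeasurableD bC2 bh) Ch0.
rewrite !bRintegralD// (pos _ bC2); first by move/addrI.
by move=> x; exact: le_trans (hC point).
Qed.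

(** A piece V_i of [M] is represented by [W i] and [phi]: a random point of V_i is [phi z] with [z]
    drawn from [m i], which avoids any question about measurability of images. The last clause, from
    injectivity of [f] and disjointness of the [W i], makes the chosen points distinct. *)
Lemma rectifiable_pieces (R : realType) (M : pmetricType R)
    (mu : probability (borel M) R) d
    (nu : {finite_measure set (d.-tuple R) -> \bar R})
    (O : set (d.-tuple R)) (f : d.-tuple R -> M) (N : nat) :
  (0 < d)%N -> (0 < N)%N -> rectification mu nu O f ->
  exists (phi : d.-tuple R -> borel M)
    (m : nat -> {finite_measure set (d.-tuple R) -> \bar R})
    (W : nat -> set (d.-tuple R)) (D : nat -> R),
  [/\ measurable_fun [set: d.-tuple R] phi /\
        (forall i, (i < N)%N -> concentrated m W N%:R i),
      forall h, bmeasurable h ->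
        \int[mu]_x h x = \sum_(i < N) \int[m i]_z h (phi z),
      forall i z z', (i < N)%N -> W i z -> W i z' ->
        mdist (phi z : M) (phi z') <= D i,
      \sum_(i < N) D i <= Lip O f * (d%:R * 2 ^+ d.-1 * N%:R `^ (1 - d%:R^-1)) &
      forall i j z z', (i < N)%N -> (j < N)%N -> W i z -> W j z' ->
        phi z = phi z' -> i = j].
Proof.
move=> d0 N0 hf; have [_ [Ocube _] [finj Olip] _ _] := hf.
have [tau [phi [S [[mS Scube SO] [tS tSC] tau0 [mphi phif] muE]]]] :=
  rectification_param hf.
have [W [D [mW SW dW WD sD]]] := exists_equipartition d0 N0 tau0 mS Scube tS.
have WS i z : (i < N)%N -> W i z -> S z by rewrite SW => iN Wz; exists i.
have Hm i : exists m : {finite_measure set (d.-tuple R) -> \bar R},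
    (i < N)%N -> forall A, m A = tau (A `&` W i).
  (* Nothing is known of [W i] beyond [N]; [tau] is a filler there. *)
  have [iN|iN] := boolP (i < N)%N; last by exists tau.
  by have [m Hm] := exists_mrestr tau (mW i iN).1; exists m.
have [m {}Hm] := choice Hm.
(* [S] has measure 1 and hyperplanes have measure 0, so [S] contains two points that differ in
   coordinate [k], hence at positive distance. *)
have Lip0 : 0 <= Lip O f.
  pose k : 'I_d := Ordinal d0.
  have mk c : measurable [set z : d.-tuple R | tnth z k = c].
    rewrite (_ : mkset _ = (@tnth d R)^~ k @^-1` [set c])//.
    by rewrite -[X in measurable X]setTI; exact: measurable_tnth.
  have [z0 Sz0] : S !=set0.
    apply/set0P/eqP => S0; move: tS; rewrite S0 measure0 => /esym/eqP.
    by rewrite eqe oner_eq0.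
  have [z1 [Sz1 /eqP z10]] : exists z1, S z1 /\ tnth z1 k <> tnth z0 k.
    apply: contrapT => /forallNP H; have : (tau S <= 0)%E.
      rewrite -(tau0 k (tnth z0 k)) le_measure ?inE// => z Sz.
      by have /not_andP[//|/contrapT] := H z.
    by rewrite tS lee_fin ler10.
  by apply: Lip_ge0 Olip _ _ _ _ _ z10; exact: SO.
exists phi, m, W, (fun i => Lip O f * D i); split.
- split=> // i iN; have [mWi tWi] := mW i iN; split => //.
    by rewrite Hm// setICl measure0.
  by rewrite Hm// setTI.
- move=> h bh; rewrite (bRintegral_transport mphi muE bh).
  apply: bRintegral_measure_sum; last exact: bmeasurable_comp bh.
  move=> A mA; transitivity (tau (A `&` S)).
    rewrite -[in LHS](setIT A) -(setUv S) setIUr measureU//.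
    + rewrite [X in (_ + X)%E](_ : _ = 0%E) ?adde0//.
      apply: (subset_measure0 _ _ _ tSC) => //; last exact: measurableC.
      by apply: measurableI => //; exact: measurableC.
    + exact: measurableI.
    + by apply: measurableI => //; exact: measurableC.
    + by rewrite setIACA setICr setI0.
  rewrite SW setI_bigcupr measure_fin_bigcup//.
  + by rewrite -fsbig_ord; apply: eq_bigr => i _; rewrite Hm.
  + exact: trivIset_setIl.
  + by move=> i iN; apply: measurableI => //; case: (mW i iN).
- move=> i z z' iN Wz Wz'; have Sz := WS _ _ iN Wz; have Sz' := WS _ _ iN Wz'.
  rewrite !phif// (le_trans (mdist_Lip Olip (SO _ Sz) (SO _ Sz')))//.
  by rewrite ler_wpM2l// (WD i).
- by rewrite -mulr_sumr ler_wpM2l.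
- move=> i j z z' iN jN Wz Wz'; have Sz := WS _ _ iN Wz; have Sz' := WS _ _ jN Wz'.
  rewrite !phif// => /(finj z z'); rewrite !inE => /(_ (SO _ Sz) (SO _ Sz')) zz'.
  by apply: (dW i j iN jN); exists z; split => //; rewrite zz'.
Qed.

(** * Sums of distances *)

Lemma exists_fset_of_injective (M : choiceType) (N : nat) (x : nat -> M) :
  (forall i j, (i < N)%N -> (j < N)%N -> x i = x j -> i = j) ->
  exists D : {fset M}, #|` D|%fset = N /\
    forall (R : nmodType) (F : M -> R),
      \sum_(y <- D) F y = \sum_(i < N) F (x i).
Proof.
move=> xinj; pose s := [seq x i | i <- iota 0 N].
have us : uniq s.
  rewrite map_inj_in_uniq ?iota_uniq// => i j.
  by rewrite !mem_iota !add0n; exact: xinj.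
exists [fset y in s]%fset.
have Ds : perm_eq [fset y in s]%fset s.
  by apply: uniq_perm => // y; rewrite inE.
split; first by rewrite (perm_size Ds) size_map size_iota.
move=> R F; rewrite (perm_big _ Ds)/= big_map.
by rewrite -(big_mkord xpredT (fun i => F (x i))) /index_iota subn0.
Qed.

(** Brings sums over ordered pairs to the triangular form of [select_kernel]. *)
Lemma sum_symmetric (V : nmodType) (N : nat) (a : nat -> nat -> V) :
  (forall i j, a i j = a j i) ->
  \sum_(i < N) \sum_(j < N) a i j =
  \sum_(i < N) ((\sum_(j < i) a i j) *+ 2 + a i i).
Proof.
move=> sym; elim: N => [|N IH]; first by rewrite !big_ord0.
rewrite !big_ord_recr/= -IH mulr2n.
under eq_bigr do rewrite big_ord_recr/=.
rewrite big_split/= -!addrA; congr (_ + _); congr (_ + _).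
by apply: eq_bigr => i _; rewrite sym.
Qed.

Section MetricSum.
Context (R : realType) (M : pmetricType R).
Hypothesis hM : compact [set: M].
Variables (mu : probability (borel M) R) (d : nat)
  (nu : {finite_measure set (d.-tuple R) -> \bar R})
  (O : set (d.-tuple R)) (f : d.-tuple R -> M).
Hypotheses (d_gt0 : (0 < d)%N) (hf : rectification mu nu O f).

Lemma bmeasurable_metric_kernel (rho : M -> M -> R) (c0 : R) :
  0 < c0 -> is_metric rho -> (forall x y, rho x y <= c0 * mdist x y) ->
  bmeasurable (fun p : borel M * borel M => rho p.1 p.2).
Proof.
move=> c00 mrho lerho; split; first exact: measurable_fun_metric_kernel lerho.
have [C HC] := mdist_bounded hM; exists (c0 * C) => p.
have [rho0 _ _ _] := mrho; rewrite ger0_norm// (le_trans (lerho _ _))//.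
by rewrite ler_wpM2l// ltW.
Qed.

Lemma le_max_metric_sum (rho : M -> M -> R) (c0 : R) (N : nat) :
  0 < c0 -> is_metric rho -> (forall x y, rho x y <= c0 * mdist x y) ->
  (0 < N)%N ->
  (mean_metric mu rho * (N%:R ^+ 2)%:E
   - (c0 * (Lip O f * (d%:R * 2 ^+ d.-1 * N%:R `^ (1 - d%:R^-1))))%:E
   <= max_metric_sum rho N)%E.
Proof.
move=> c00 mrho lerho N0; have [rho0 rhoP rhoC _] := mrho.
have brho := bmeasurable_metric_kernel c00 mrho lerho.
have NR0 : 0 < N%:R :> R by rewrite ltr0n.
have [phi [m [W [D [[mphi cW] muE WD sD phiinj]]]]] :=
  rectifiable_pieces d_gt0 N0 hf.
pose K (p : d.-tuple R * d.-tuple R) : R := rho (phi p.1) (phi p.2).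
have bK : bmeasurable K.
  apply: (@bmeasurable_comp _ _ _ _ _
    (fun p : d.-tuple R * d.-tuple R => (phi p.1, phi p.2)) _ _ brho).
  apply: measurable_fun_pair; apply: measurableT_comp => //.
pose a i j := \int[m i]_x \int[m j]_y K (x, y).
have aC i j : a i j = a j i.
  rewrite /a bRintegral_swap//; apply: eq_Rintegral => y _.
  by apply: eq_Rintegral => x _; rewrite /K rhoC.
have bKm j : bmeasurable (fun x => \int[m j]_y K (x, y)).
  exact: (bmeasurable_Rintegral (m 0%N)).
have brho1 : bmeasurable (fun x : borel M => \int[mu]_y rho x y).
  exact: (bmeasurable_Rintegral mu mu brho).
have mean : mean_metric mu rho = (\sum_(i < N) \sum_(j < N) a i j)%:E.
  rewrite /mean_metric.
  transitivity (\int[mu]_x \int[mu]_y rho x y)%:E.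
    rewrite EFin_Rintegral//; apply: eq_integral => x _.
    rewrite EFin_Rintegral//; exact: (bmeasurable_pair2 x brho).
  rewrite muE//; congr EFin; apply: eq_bigr => i _.
  rewrite /a -bRintegral_sum//; apply: eq_Rintegral => x _.
  by rewrite (muE _ (bmeasurable_pair2 (phi x) brho)).
(* Both integrations run over mass 1/N, which cancels the factor N^2. *)
have diag (i : 'I_N) : N%:R ^+ 2 * a i i <= c0 * D i.
  have [mWi Wi0 mi] := cW i (ltn_ord i).
  have mi0 : (0 < m i [set: d.-tuple R])%E by rewrite mi lte_fin invr_gt0.
  have bound h c : bmeasurable h -> (forall z, W i z -> h z <= c) ->
      \int[m i]_x h x <= c * N%:R^-1.
    by move=> bh hc; have := bRintegral_le_cst mWi Wi0 mi0 bh hc; rewrite [X in fine X]mi.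
  have : a i i <= c0 * D i * N%:R^-1 * N%:R^-1.
    apply: (bound _ _) => // z Wz; apply: (bound _ _); first exact: bmeasurable_pair2.
    move=> z' Wz'; rewrite /K /= (le_trans (lerho _ _))// ler_wpM2l ?(ltW c00)//.
    exact: (WD i).
  rewrite -(ler_pM2l (exprn_gt0 2 NR0)) => /le_trans; apply.
  by rewrite le_eqVlt; apply/orP; left; apply/eqP; field; rewrite gt_eqF.
pose g (i : nat) (x : d.-tuple R) : R := 0.
have bg i : bmeasurable (g i) by exact: bmeasurable_cst.
have [z Wz Hz] := select_kernel NR0 cW bK bg.
have zinj i j : (i < N)%N -> (j < N)%N -> (phi (z i) : M) = phi (z j) -> i = j.
  by move=> iN jN; apply: phiinj => //; exact: Wz.
have [E [EN sE]] := exists_fset_of_injective zinj.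
apply: (@le_trans _ _ (metric_sum rho E)%:E); last first.
  by apply: ereal_sup_ubound; exists E.
rewrite mean -EFinM -EFinB lee_fin /metric_sum sE.
under [leRHS]eq_bigr do rewrite sE.
(* Both energies split into a triangular part, compared by the selection, and a diagonal, which is
   zero for the chosen points and at most the sum of the [c0 * D i] for the average. *)
rewrite (sum_symmetric N aC) (sum_symmetric N (a := fun i j => rho (phi (z i)) (phi (z j))))//.
rewrite !big_split/= [X in _ <= _ + X]big1; last by move=> i _; apply/rhoP.
rewrite addr0 mulrDl -[leRHS]addr0 -addrA; apply: lerD; last first.
  rewrite subr_le0; apply: (@le_trans _ _ (\sum_(i < N) c0 * D i)).
    by rewrite mulr_suml; apply: ler_sum => i _; rewrite mulrC.
  by rewrite -mulr_sumr ler_wpM2l// ltW.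
rewrite -!mulr2n mulrnAl lerMn2r/= mulr_suml.
move: Hz; rewrite [leRHS]big_split/= [X in _ <= _ + X -> _]big1// addr0.
apply: le_trans; apply: ler_sum => i _.
rewrite /g Rintegral_cst// mul0r mulr0 addr0 mulr_suml.
by apply: ler_sum => j _; rewrite mulrC.
Qed.

End MetricSum.

(** * Discrepancies *)

Lemma closed_inf (R : realType) (A H : set R) :
  closed A -> H `<=` A -> has_inf H -> A (inf H).
Proof.
move=> cA HA iH; apply: cA => B /nbhs_ballP[e /= e0 eB].
have [x Hx xe] := inf_adherent e0 iH.
exists x; split; first exact: HA.
apply: eB; rewrite /ball/= distrC ger0_norm ?ltrBlDl//.
by rewrite subr_ge0; apply: ge_inf => //; case: iH.
Qed.

Lemma closed_sup (R : realType) (A H : set R) :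
  closed A -> H `<=` A -> H !=set0 -> has_ubound H -> A (sup H).
Proof. by move=> cA HA H0 bH; apply: cA; apply: (closureS HA); exact: closure_sup. Qed.

Section Discrepancy.
Context (R : realType) (M : pmetricType R).
Hypothesis hM : compact [set: M].
Variables (mu : probability (borel M) R) (d : nat)
  (nu : {finite_measure set (d.-tuple R) -> \bar R})
  (O : set (d.-tuple R)) (f : d.-tuple R -> M).
Hypotheses (d_gt0 : (0 < d)%N) (hf : rectification mu nu O f).
Variables (xi : {measure set R -> \bar R}) (c0 : R).
Hypotheses (c0_gt0 : 0 < c0)
  (xi_le : forall a b : R, radii M a -> radii M b -> a <= b ->
     (xi ([set` `[a, b[%R] `&` radii M) <= (c0 * `|a - b|)%:E)%E).

Let has_ubound_radii : has_ubound (radii M).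
Proof. by have [C HC] := mdist_bounded hM; exists C => _ [x [y ->]]. Qed.

Let radii0 : radii M 0.
Proof. by exists point, point; rewrite mdistxx. Qed.

Let diam : R := sup (radii M).

Let radii_diam : radii M diam.
Proof. by apply: (closed_sup (closed_radii hM)) => //; exists 0. Qed.

Let mdist_le_diam (x y : M) : mdist x y <= diam.
Proof. by apply: ub_le_sup => //; exists x, y. Qed.

Let measurable_radii : measurable (radii M).
Proof. exact: closed_measurable (closed_radii hM). Qed.

(* [xi] may charge the diameter with infinite mass, since [xi_le] only controls
   half-open intervals; the discrepancy vanishes at that radius. *)
Let small_radii : set R := [set` `[0, diam[%R] `&` radii M.

Let measurable_small_radii : measurable small_radii.
Proof. exact: measurableI. Qed.

Let xi_fin : (xi small_radii < +oo)%E.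
Proof.
apply: (le_lt_trans (xi_le radii0 radii_diam _)); last exact: ltry.
by apply: (le_trans _ (mdist_le_diam point point)); exact: mdist_ge0.
Qed.

Let xi' : {finite_measure set R -> \bar R} := mfrestr measurable_small_radii xi_fin.

Lemma measurable_cball r y : measurable (cball r y : set (borel M)).
Proof.
have mk := @measurable_fun_metric_kernel R M hM (@mdist R M) 1 ltr01 (is_metric_mdist M).
apply: (@measurable_sublevel _ _ _ (fun x : borel M => mdist (x : M) y)).
apply: (measurable_fun_pair1 (f := fun p : borel M * borel M => mdist (p.1 : M) p.2)).
by apply: mk => u v; rewrite mul1r.
Qed.

Lemma min_discrepancy_le (N : nat) : (0 < N)%N ->
  (min_discrepancy mu xi N <=
   (4^-1 * c0 * (Lip O f * (d%:R * 2 ^+ d.-1 * N%:R `^ (1 - d%:R^-1))))%:E)%E.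
Proof.
move=> N0; have NR0 : 0 < N%:R :> R by rewrite ltr0n.
have [phi [m [W [D [[mphi cW] muE WD sD phiinj]]]]] :=
  rectifiable_pieces d_gt0 N0 hf.
(* A ball is a pair of radius and centre. Over the product measure [P] the discrepancy becomes a
   single integral of a square, to which [select_variance] applies with [u = (r, y)]. *)
pose Om := (R * borel M)%type.
pose B : set (Om * d.-tuple R) := [set w | mdist (phi w.2 : M) w.1.2 <= w.1.1].
have mB : measurable B.
  rewrite (_ : B = [set w : Om * d.-tuple R | mdist (phi w.2 : M) w.1.2 - w.1.1 <= 0]).
    apply: measurable_sublevel; apply: measurable_funB.
      apply: (@measurableT_comp _ _ _ _ _ _ (fun p : borel M * borel M => mdist (p.1 : M) p.2)
        _ (fun w : Om * d.-tuple R => (phi w.2, w.1.2))).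
        apply: (@measurable_fun_metric_kernel R M hM (@mdist R M) 1 ltr01 (is_metric_mdist M)).
        by move=> u v; rewrite mul1r.
      apply: measurable_fun_pair; first exact: measurableT_comp.
      by apply: (measurableT_comp measurable_snd); exact: measurable_fst.
    by apply: (measurableT_comp measurable_fst); exact: measurable_fst.
  by apply/seteqP; split => w /=; rewrite subr_le0.
pose chi (w : Om * d.-tuple R) : R := \1_B w.
have bchi : bmeasurable chi.
  split; first exact: measurable_indic.
  by exists 1 => w; rewrite /chi indicE; case: (_ \in _); rewrite ?normr1 ?normr0.
have chi2 w : chi w ^+ 2 = chi w.
  by rewrite /chi indicE; case: (_ \in _); rewrite ?expr1n ?expr0n.
pose P : {finite_measure set Om -> \bar R} := finite_product xi' mu.
have := @select_variance _ _ _ m W N%:R N NR0 _ _ P chi cW bchi chi2.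
set p := fun i u => _ => -[z Wz Hz].
have zinj i j : (i < N)%N -> (j < N)%N -> (phi (z i) : M) = phi (z j) -> i = j.
  by move=> iN jN; apply: phiinj => //; exact: Wz.
have [E [EN sE]] := exists_fset_of_injective zinj.
have bchiz x : bmeasurable (fun u => chi (u, x)) by exact: bmeasurable_pair1.
have bchiu u : bmeasurable (fun x => chi (u, x)) by exact: bmeasurable_pair2.
have bp i : bmeasurable (p i).
  by apply: bmeasurableZ; exact: (bmeasurable_Rintegral P).
pose L u := \sum_(i < N) (chi (u, z i) - p i u).
have bL : bmeasurable L by apply: bmeasurable_sum => i; exact: bmeasurableB.
have bL2 : bmeasurable (fun u => L u ^+ 2).
  by under eq_fun do rewrite expr2; exact: bmeasurableM.
(* Transported to the pieces, N times the measure of the ball is the sum of the [p i], so the local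
   discrepancy is a sum of centred terms. *)
have localE r y : local_discrepancy mu r y E = L (r, y).
  rewrite /local_discrepancy /L sumrB EN; congr (_ - _).
    transitivity (\sum_(x <- E) (x \in cball r y)%:R : R).
      have Ey : perm_eq [fset x in E | x \in cball r y]%fset
          [seq x <- E | x \in cball r y].
        apply: uniq_perm; rewrite ?filter_uniq ?fset_uniq// => x.
        by rewrite mem_filter !inE/= andbC.
      rewrite -natr_sum (perm_size Ey) size_filter -sum1_count big_mkcond/=.
      by congr _%:R; apply: eq_bigr => x _; case: (_ \in _).
    rewrite sE; apply: eq_bigr => i _; rewrite /chi indicE.
    by congr (nat_of_bool _)%:R; apply/idP/idP; rewrite !inE.
  rewrite /p -mulr_sumr; congr (_ * _).
  have mb : measurable (cball r y : set (borel M)) by exact: measurable_cball.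
  have bb : bmeasurable (\1_(cball r y : set (borel M)) : borel M -> R).
    split; first exact: measurable_indic.
    by exists 1 => x; rewrite indicE; case: (_ \in _); rewrite ?normr1 ?normr0.
  transitivity (\int[mu]_x (\1_(cball r y : set (borel M)) x : R)).
    by rewrite /Rintegral integral_indic// setIT.
  by rewrite muE.
have local_diam y : local_discrepancy mu diam y E = 0.
  have cT : cball diam y = setT.
    by apply/seteqP; split => // x _; exact: mdist_le_diam.
  rewrite /local_discrepancy cT probability_setT mulr1.
  rewrite (_ : [fset x in E | _]%fset = E) ?subrr//.
  by apply/fsetP => x; rewrite !inE/= in_setT andbT.
have bL2r r : bmeasurable (fun y => L (r, y) ^+ 2) by exact: (bmeasurable_pair2 r bL2).
have bL2y : bmeasurable (fun r => \int[mu]_y (L (r, y) ^+ 2)).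
  exact: (bmeasurable_Rintegral xi' mu bL2).
have discE : (discrepancy mu xi E <= (\int[P]_u (L u ^+ 2))%:E)%E.
  have atE r : discrepancy_at mu r E = (\int[mu]_y (L (r, y) ^+ 2))%:E.
    by rewrite EFin_Rintegral//; apply: eq_integral => y _; rewrite localE.
  rewrite (@Rintegral_prod _ _ _ _ _ xi' mu (fun u => L u ^+ 2))//.
  rewrite EFin_Rintegral// /discrepancy integral_mkcond.
  rewrite (_ : _ \_ _ = (discrepancy_at mu ^~ E) \_ small_radii); last first.
    apply/funext => r; rewrite !patchE; case: ifPn => [/set_mem rM|/negP rM].
      have [x [y rxy]] := rM.
      case: ifPn => //; rewrite notin_setE => rS.
      have -> : r = diam.
        apply/eqP; rewrite eq_le {1}rxy mdist_le_diam/= leNgt; apply/negP => rd.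
        by apply: rS; split => //=; rewrite in_itv/= rd rxy mdist_ge0.
      by rewrite /discrepancy_at integral0_eq// => u _; rewrite local_diam expr0n.
    by rewrite memNset// => -[_ /mem_set].
  rewrite -integral_mkcond (eq_measure_integral xi'); last first.
    by move=> A mA AS; rewrite /xi' /= /mfrestr /mrestr setIidl.
  rewrite (eq_integral (fun r => (\int[mu]_y (L (r, y) ^+ 2))%:E)); last first.
    by move=> r _; exact: atE.
  apply: ge0_subset_integral => //.
    by apply/measurable_EFinP; case: bL2y.
  by move=> r _; rewrite lee_fin Rintegral_ge0// => y _; exact: sqr_ge0.
have chi_ge0 w : 0 <= chi w by rewrite /chi indicE.
have chi_le1 w : chi w <= 1 by rewrite /chi indicE; case: (_ \in _).
have avg_le i h c : (i < N)%N -> bmeasurable h -> (forall x, W i x -> h x <= c) ->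
    N%:R * \int[m i]_x h x <= c.
  move=> iN bh hc; have [x Wx] := concentrated_exists NR0 (cW i iN) bh.
  by move/le_trans; apply; exact: hc.
have p_compl i u : (i < N)%N -> 1 - p i u = N%:R * \int[m i]_x (1 - chi (u, x)).
  move=> iN; have [_ _ mT] := cW i iN.
  rewrite bRintegralB//; last exact: bmeasurable_cst.
  rewrite Rintegral_cst// [X in fine X]mT mul1r mulrBr mulfV ?gt_eqF//.
have p_ge0 i u : 0 <= p i u by rewrite mulr_ge0// Rintegral_ge0.
have p_le1 i u : (i < N)%N -> p i u <= 1.
  by move=> iN; apply: avg_le.
have var_le (i : 'I_N) : \int[P]_u (p i u * (1 - p i u)) <= 4^-1 * c0 * D i.
  have iN := ltn_ord i; pose v u := p i u * (1 - p i u).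
  have bv : bmeasurable v.
    by apply: bmeasurableM => //; apply: bmeasurableB => //; exact: bmeasurable_cst.
  (* With the centre fixed and the radius integrated first, only the spread of the distances from
     [y] to the piece matters. *)
  rewrite (@Rintegral_prod _ _ _ _ _ xi' mu v)// (bRintegral_swap _ _ bv).
  have bvy y : bmeasurable (fun r => v (r, y)) by exact: (bmeasurable_pair1 y bv).
  (* For fixed [y] the fraction [p] is 0 for [r < al] and 1 for [r >= be]; in
     between, [p * (1 - p) <= 1 / 4]. The endpoints are radii because the set of
     radii is closed. *)
  have key y : \int[xi']_r v (r, y) <= 4^-1 * c0 * D i.
    pose H := [set mdist (phi x : M) y | x in W i].
    have Hr : H `<=` radii M by move=> _ [x _ <-]; exists (phi x), y.
    have H0 : H !=set0.
      (* The constant function only serves to extract a point of [W i], which has positive mass. *)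
      have [x Wx _] := concentrated_exists NR0 (cW i iN) (bmeasurable_cst _ 0).
      by exists (mdist (phi x : M) y); exists x.
    have ubH : has_ubound H by exists diam => _ [x _ <-]; exact: mdist_le_diam.
    have lbH : has_lbound H by exists 0 => _ [x _ <-]; exact: mdist_ge0.
    pose al := inf H; pose be := sup H.
    have ral : radii M al by apply: (closed_inf (closed_radii hM)).
    have rbe : radii M be by apply: (closed_sup (closed_radii hM)).
    have alH h : H h -> al <= h by exact: ge_inf.
    have beH h : H h -> h <= be by exact: ub_le_sup.
    have albe : al <= be.
      by have [h Hh] := H0; rewrite (le_trans (alH h Hh))// beH.
    have beal : be - al <= D i.
      rewrite lerBlDr; apply: sup_le_ub => // _ [x Wx <-].
      rewrite -lerBlDl; apply: lb_le_inf => // _ [x' Wx' <-].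
      rewrite lerBlDr (le_trans (metric_triangle _ (phi x') _))// addrC lerD2l.
      exact: (WD i).
    have mA : measurable (`[al, be[%classic : set R) by exact: measurable_itv.
    have bI : bmeasurable (\1_(`[al, be[%classic : set R) : R -> R).
      split; first exact: measurable_indic.
      by exists 1 => r; rewrite indicE; case: (_ \in _); rewrite ?normr1 ?normr0.
    have bA := bmeasurableZ 4^-1 bI.
    apply: (@le_trans _ _ (\int[xi']_r (4^-1 * \1_(`[al, be[%classic : set R) r))).
      apply: le_bRintegral => // r; rewrite indicE /v.
      have := p_ge0 i (r, y); have := p_le1 i (r, y) iN.
      case: (boolP (r \in _)); rewrite ?inE ?notin_setE /= in_itv/= => rA p1 p0.
        rewrite mulr1; have := sqr_ge0 (p i (r, y) - 2^-1); rewrite expr2; nra.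
      rewrite mulr0; have [r_al|alr] := ltP r al.
        suff : p i (r, y) <= 0 by nra.
        apply: avg_le => // x Wx; rewrite /chi indicE memNset// /B/=.
        by apply/negP; rewrite -ltNge (lt_le_trans r_al)// alH//; exists x.
      (* Balls are closed, so at [r = be] the whole piece is already inside; this is why the
         half-open intervals of [xi_le] suffice. *)
      have ber : be <= r.
        by rewrite leNgt; apply/negP => rbe'; apply: rA; rewrite alr.
      suff : 1 - p i (r, y) <= 0 by nra.
      rewrite p_compl//; apply: avg_le => //.
        by apply: bmeasurableB => //; exact: bmeasurable_cst.
      move=> x Wx; rewrite /chi indicE mem_set ?subrr// /B/=.
      by rewrite (le_trans _ ber)// beH//; exists x.
    rewrite bRintegralZ// -mulrA ler_wpM2l// ?invr_ge0//.
    apply: (@le_trans _ _ (c0 * (be - al))); last by rewrite ler_wpM2l// ltW.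
    rewrite /Rintegral integral_indic// setIT -lee_fin fineK ?fin_num_measure//.
    apply: (@le_trans _ _ (xi (`[al, be[%classic `&` radii M))).
      rewrite /xi' /= /mfrestr /mrestr le_measure ?inE//.
      - exact: measurableI.
      - exact: measurableI.
      - by move=> r [? []].
    by rewrite (le_trans (xi_le ral rbe albe))// distrC ger0_norm// subr_ge0.
  apply: (@le_trans _ _ (\int[mu]_y (4^-1 * c0 * D i))).
    apply: le_bRintegral; last exact: key; last exact: bmeasurable_cst.
    apply: (bmeasurable_Rintegral mu xi' (F := fun w : borel M * R => v (w.2, w.1))).
    apply: (@bmeasurable_comp _ _ _ _ _ (fun w : borel M * R => (w.2, w.1)) v) => //.
    exact: measurable_swap.
  by rewrite Rintegral_cst// [X in fine X]probability_setT mulr1.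
apply: (@le_trans _ _ (discrepancy mu xi E)).
  by apply: ereal_inf_lbound; exists E.
apply: (le_trans discE); rewrite lee_fin (le_trans Hz)//.
apply: (le_trans (ler_sum _ (fun i _ => var_le i))).
by rewrite -mulr_sumr ler_wpM2l// mulr_ge0// ltW.
Qed.
End Discrepancy.

Theorem theorem1p1 (R : realType) (M : pmetricType R)
    (hM : compact [set: M]) (mu : probability (borel M) R)
    (d : nat) (hd : (0 < d)%N)
    (nu : {finite_measure set (d.-tuple R) -> \bar R})
    (O : set (d.-tuple R)) (f : d.-tuple R -> M)
    (hf : rectification mu nu O f) :
  (forall (rho : M -> M -> R) (c0 : R),
     is_metric rho -> 0 < c0 ->
     (forall x1 x2, rho x1 x2 <= c0 * mdist x1 x2) ->
     forall N : nat, (1 <= N)%N ->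
       (mean_metric mu rho * (N%:R ^+ 2)%:E
        - (d%:R * 2 ^ (d%:Z - 1) * Lip O f * c0 * N%:R `^ (1 - d%:R^-1))%:E
        <= max_metric_sum rho N)%E)
  /\
  (forall (xi : {measure set R -> \bar R}) (c0 : R),
     0 < c0 ->
     (forall a b : R, radii M a -> radii M b -> a <= b ->
        (xi ([set` `[a, b[%R] `&` radii M) <= (c0 * `|a - b|)%:E)%E) ->
     forall N : nat, (1 <= N)%N ->
       (min_discrepancy mu xi N
        <= (d%:R * 2 ^ (d%:Z - 3) * Lip O f * c0
            * N%:R `^ (1 - d%:R^-1))%:E)%E).
Proof.
(* Exponents are integers because d - 3 may be negative; 2^(d-3) is 2^(d-1) times the variance bound
   1/4. *)
have pow1 : 2 ^ (d%:Z - 1) = 2 ^+ d.-1 :> R.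
  by rewrite -[d in LHS](prednK hd) intS addrAC subrr add0r.
have pow3 : 2 ^ (d%:Z - 3) = 2 ^+ d.-1 / 4 :> R.
  rewrite (_ : d%:Z - 3 = (d%:Z - 1) - 2); last by lia.
  rewrite expfzDr ?pnatr_eq0// pow1; congr (_ * _).
  by rewrite -invr_expz -exprnP expr2 -natrM.
split=> [rho c0 mrho c0_gt0 lerho N N0|xi c0 c0_gt0 xi_le N N0].
  apply: le_trans (le_max_metric_sum hM hd hf c0_gt0 mrho lerho N0).
  by rewrite leeB// lee_fin pow1; lra.
apply: (le_trans (min_discrepancy_le hM hd hf c0_gt0 xi_le N0)).
by rewrite lee_fin pow3; lra.
Qed.
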